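(* There is an algorithm which, given a pair $(G,\ell)$, where $G$ is a finite simple undirected graph with $n$ vertices and $m$ edges and $\ell$ is a non-negative integer, decides whether $\alpha(G)\ge a(G)-\ell$ in time $O\left(15^{(3\ell+1)}\,\ell\,(n+m)^3\right)$.
   Context: For a finite simple undirected graph $G$ with $n\ge 1$ vertices, $m$ edges, and degree sequence $d_1\le d_2\le\cdots\le d_n$ (vertex degrees sorted in nondecreasing order), the annihilation number is $a(G)=\max\{a\in\{1,\ldots,n\}: d_1+\cdots+d_a\le m\}$. The independence number $\alpha(G)$ is the maximum cardinality of a set of pairwise non-adjacent vertices of $G$.
   Formalization: The factor ℓ in the time bound is read as max(ℓ,1), because for ℓ = 0 the stated bound would be 0 steps, which no algorithm can meet; for ℓ ≥ 1 the bound is as stated. *)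

(* Defs.v *)
From mathcomp Require Import all_boot.

Set Implicit Arguments.
Unset Strict Implicit.
Unset Printing Implicit Defensive.

(** * Graph parameters

    A finite simple undirected graph on the vertex set [T] is a symmetric and
    irreflexive relation [e : rel T]; both properties are hypotheses wherever
    the definitions below are used. *)

Section GraphParameters.
Variables (T : finType) (e : rel T).

Definition edges : {set {set T}} :=
  [set [set p.1; p.2] | p in [pred p : T * T | e p.1 p.2]].

Definition num_edges : nat := #|edges|.

Definition degree (v : T) : nat := #|[set w | e v w]|.

Definition degree_seq : seq nat := sort leq [seq degree v | v : T].

(* For a nonempty vertex set the range contains a valid [a] (namely [a = 1]),
   so the convention that an empty maximum is 0 plays no role. *)
Definition annihilation_number : nat :=
  \max_(1 <= a < #|T|.+1 | sumn (take a degree_seq) <= num_edges) a.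

Definition independent (S : {set T}) : bool :=
  [forall u in S, forall v in S, ~~ e u v].

Definition independence_number : nat :=
  \max_(S : {set T} | independent S) #|S|.

(* [s] lists every edge exactly once, in any order, each edge being written
   with its two end points in any order. *)
Definition edge_listing (s : seq (T * T)) : bool :=
  perm_eq [seq [set p.1; p.2] | p <- s] (enum edges).

End GraphParameters.

(** * Random access machine

    Programs run on a random access machine with numbered registers and an
    unbounded memory, both holding natural numbers, under the uniform cost
    criterion.  Control flow is structured (loops instead of
    jumps), which affects running times by constant factors only.  Addition
    and truncated subtraction are the only arithmetic operations: with
    multiplication at unit cost the model would no longer be reasonable. *)

Inductive expr : Type :=
| Const of nat
| Reg of nat
| Mem of expr
| Add of expr & expr
| Sub of expr & expr.

Inductive program : Type :=
| Skip
| Assign of nat & expr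
| Store of expr & expr
| Seq of program & program
| If of expr & program & program
| While of expr & program.

Record state : Type := State { regs : nat -> nat; memory : nat -> nat }.

Fixpoint eval (st : state) (x : expr) : nat :=
  match x with
  | Const k => k
  | Reg r => regs st r
  | Mem y => memory st (eval st y)
  | Add y z => eval st y + eval st z
  | Sub y z => eval st y - eval st z
  end.

Fixpoint eval_cost (x : expr) : nat :=
  match x with
  | Const _ | Reg _ => 1
  | Mem y => (eval_cost y).+1
  | Add y z | Sub y z => (eval_cost y + eval_cost z).+1
  end.

Definition set_reg (st : state) (r v : nat) : state :=
  State [eta regs st with r |-> v] (memory st).

Definition set_mem (st : state) (a v : nat) : state :=
  State (regs st) [eta memory st with a |-> v].

(* [exec c st t st']: started in [st], the program [c] halts in [st'] after
   exactly [t] steps.  A test succeeds when its value is nonzero. *)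
Inductive exec : program -> state -> nat -> state -> Prop :=
| ExecSkip st : exec Skip st 1 st
| ExecAssign st r x :
    exec (Assign r x) st (eval_cost x).+1 (set_reg st r (eval st x))
| ExecStore st x y :
    exec (Store x y) st (eval_cost x + eval_cost y).+1
      (set_mem st (eval st x) (eval st y))
| ExecSeq c1 c2 st1 st2 st3 t1 t2 :
    exec c1 st1 t1 st2 -> exec c2 st2 t2 st3 ->
    exec (Seq c1 c2) st1 (t1 + t2) st3
| ExecIfTrue x c1 c2 st st' t :
    eval st x != 0 -> exec c1 st t st' ->
    exec (If x c1 c2) st (eval_cost x + t).+1 st'
| ExecIfFalse x c1 c2 st st' t :
    eval st x = 0 -> exec c2 st t st' ->
    exec (If x c1 c2) st (eval_cost x + t).+1 st'
| ExecWhileFalse x c st :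
    eval st x = 0 -> exec (While x c) st (eval_cost x).+1 st
| ExecWhileTrue x c st1 st2 st3 t1 t2 :
    eval st1 x != 0 -> exec c st1 t1 st2 -> exec (While x c) st2 t2 st3 ->
    exec (While x c) st1 (eval_cost x + t1 + t2).+1 st3.

Lemma exec_det c st t1 st1 t2 st2 :
  exec c st t1 st1 -> exec c st t2 st2 -> t1 = t2 /\ st1 = st2.
Proof.
move=> h; elim: h t2 st2 => {c st t1 st1};
  intros; match goal with H : exec _ _ _ _ |- _ => inversion H; subst end;
  repeat match goal with
  | IH : forall _ _, exec ?c ?s _ _ -> _ , H : exec ?c ?s _ _ |- _ =>
      case: (IH _ _ H) => ? ?; subst; clear H
  | H : is_true (?a != 0), H' : ?a = 0 |- _ => by rewrite H' in H
  end; by [].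
Qed.

(* The memory initially holds [n], [m], [l], followed by the end points of the
   listed edges, and 0 everywhere else; all registers are initially 0. *)
Definition input_state (n l : nat) (s : seq ('I_n * 'I_n)) : state :=
  State (fun _ => 0)
    (nth 0 ([:: n; size s; l]
            ++ flatten [seq [:: val p.1; val p.2] | p <- s])).

(* Within [bound] steps the program halts with the truth value of the answer
   in register 0. *)
Definition answers_within (c : program) (st : state) (bound : nat)
    (answer : bool) : Prop :=
  exists t st', [/\ exec c st t st', t <= bound & regs st' 0 = answer].

(* Main.v *)
Require Import Defs.
From mathcomp Require Import all_boot.
From mathcomp Require Import zify.

(** Write a for the annihilation number and k = n + l - a; the question is
    whether there is a vertex cover of size at most k.  Let [lp D] be twice the
    least weight of a half-integral vertex cover that is 1 on D.  Comparing
    degree sums of sets of a + 1 vertices with m shows that the answer can be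
    positive only if 2k <= lp(0) + 4l + 2.  By persistency, a vertex v with
    [lp (v |: D) = lp D] can be added to D without loss; when there is none,
    adding either end of an uncovered edge increases [lp], so that 4l + 2 binary
    choices suffice, and all 2^(4l+2) sequences of choices are tried.

    By Koenig's theorem, [lp D = 2|D| + |M|] for a maximum matching M of the
    bipartite double cover of G - D, so that one search for an alternating path,
    in time O(n(n+m)), tells whether v can be added.  A round of O(n) searches
    precedes every choice, and (4l+3) 2^(4l+2) <= 15^(3l+1) max(l,1). *)

Set Implicit Arguments.
Unset Strict Implicit.
Unset Printing Implicit Defensive.

(** * Half-integral vertex covers *)

(** Doubling makes [lp] integral, so every choice raises it by at least 1, while a partial cover
    that extends to a cover of size k has [lp] at most 2k: this turns the gap 4l + 2 into a number
    of choices. The gap is 2(2l + 1): an optimal half-integral cover is compared with an independent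
    set of n - k vertices at each of its two thresholds, and each comparison contributes a Hall
    deficiency of at most 2l + 1. The value of [lp] is never computed. For v outside D and a maximum
    matching M, adding v to D contributes 2 through 2|D| and deletes at most two pairs; [lp] stays
    the same exactly if two pairs are lost and the remaining ones still form a maximum matching.
    Programs have loops but no recursion. A sequence of choices is therefore a number whose bits are
    consumed from the top, and each sequence is replayed from the empty cover. The number of rounds
    is fixed in advance; it exceeds the number of choices by one, because a last reduction is needed
    after the last choice. A round takes cubic time because it rebuilds a maximum matching by n + 1
    searches. *)

Section HalfIntegral.
Variables (T : finType) (e : rel T).
Hypothesis sym_e : symmetric e.
Implicit Types (D S : {set T}) (x : {ffun T -> 'I_3}) (M : {set T * T}).

Definition vertex_cover S := [forall u, forall w, e u w ==> (u \in S) || (w \in S)].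

Lemma vertex_coverP S :
  reflect (forall u w, e u w -> (u \in S) || (w \in S)) (vertex_cover S).
Proof.
apply: (iffP forallP) => [h u w|h u].
  by move: (h u) => /forallP/(_ w)/implyP.
by apply/forallP => w; apply/implyP; apply: h.
Qed.

Definition cover_within D k :=
  [exists S : {set T}, [&& vertex_cover S, D \subset S & #|S| <= k]].

Lemma cover_withinP D k :
  reflect (exists S, [/\ vertex_cover S, D \subset S & #|S| <= k]) (cover_within D k).
Proof.
by apply: (iffP existsP) => -[S] => [/and3P[]|[h1 h2 h3]]; exists S => //;
  apply/and3P.
Qed.

(* The values 0, 1, 2 stand for 0, 1/2, 1. *)
Definition hcover D x :=
  [forall u, forall w, e u w ==> (1 < x u + x w)] && [forall v in D, x v == 2 :> nat].

Lemma hcoverP D x :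
  reflect ((forall u w, e u w -> 1 < x u + x w) /\
           (forall v, v \in D -> x v = 2 :> nat)) (hcover D x).
Proof.
apply: (iffP andP) => -[h1 h2]; split.
- by move=> u w; move/forallP: h1 => /(_ u)/forallP/(_ w)/implyP.
- by move=> v vD; move/forallP: h2 => /(_ v)/implyP/(_ vD)/eqP.
- by apply/forallP => u; apply/forallP => w; apply/implyP; apply: h1.
- by apply/forallP => v; apply/implyP => /h2/eqP.
Qed.

Definition weight x := \sum_v x v.

Definition lp D :=
  weight [arg min_(x < [ffun=> ord_max] | hcover D x) weight x].

Lemma hcover_max D : hcover D [ffun=> ord_max].
Proof. by apply/hcoverP; split => [u w|v]; rewrite !ffunE. Qed.

Lemma lp_le D x : hcover D x -> lp D <= weight x.
Proof. by move=> hx; rewrite /lp; case: arg_minnP; [apply: hcover_max|move=> y _; apply]. Qed.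

Lemma lp_attained D : exists2 x, hcover D x & weight x = lp D.
Proof.
rewrite /lp; case: arg_minnP; first exact: hcover_max.
by move=> x hx _; exists x.
Qed.

Lemma lp_mono D D' : D \subset D' -> lp D <= lp D'.
Proof.
move=> sDD'; have [x hx <-] := lp_attained D'; apply: lp_le.
case/hcoverP: hx => h1 h2; apply/hcoverP; split=> // v vD.
exact/h2/(subsetP sDD').
Qed.

Lemma sum_mem_card (A : {set T}) : \sum_v (v \in A : nat) = #|A|.
Proof. by rewrite -sum1_card [RHS]big_mkcond; apply: eq_bigr => v _; case: (v \in A). Qed.

Lemma lp_le_cover D k : cover_within D k -> lp D <= 2 * k.
Proof.
case/cover_withinP => S [cS sDS cardS].
pose x : {ffun T -> 'I_3} := [ffun v => if v \in S then ord_max else ord0].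
have hx : hcover D x.
  apply/hcoverP; split=> [u w /(vertex_coverP _ cS)|v /(subsetP sDS) vS]; last by rewrite ffunE vS.
  by rewrite !ffunE; case: (u \in S); case: (w \in S).
apply: leq_trans (lp_le hx) _; rewrite /weight.
have -> : \sum_v (x v : nat) = \sum_v 2 * (v \in S : nat).
  by apply: eq_bigr => v _; rewrite ffunE; case: (v \in S).
by rewrite -big_distrr /= sum_mem_card leq_mul2l.
Qed.

Lemma card_le_lp D : 2 * #|D| <= lp D.
Proof.
have [x /hcoverP[_ hx] <-] := lp_attained D.
rewrite /weight -sum_mem_card big_distrr /=; apply: leq_sum => v _.
by case: (boolP (v \in D)) => // /hx ->.
Qed.

Lemma cover_within_card D k : cover_within D k -> #|D| <= k.
Proof. by move/lp_le_cover=> h; have := card_le_lp D; lia. Qed.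

(* An optimal half-integral cover [x] dictates its integral values: rounding a
   cover [z] towards [x] costs nothing, for otherwise moving [x] half way
   towards [z] would improve [x]. *)
Lemma persistency D D' k : D \subset D' -> lp D' = lp D ->
  cover_within D k -> cover_within D' k.
Proof.
move=> sDD' eqlp /cover_withinP[S [cS sDS cardS]].
have [x hx wx] := lp_attained D'; have [hx1 hx2] := hcoverP _ _ hx.
pose A := [set v | (x v == 2 :> nat) && (v \notin S)].
pose B := [set v | (x v == 0 :> nat) && (v \in S)].
pose S' := (S :\: B) :|: A.
have mA v : (v \in A) = (x v == 2 :> nat) && (v \notin S) by rewrite inE.
have mB v : (v \in B) = (x v == 0 :> nat) && (v \in S) by rewrite inE.
have cS' : vertex_cover S'.
  apply/vertex_coverP => u w euw; rewrite !in_setU !in_setD !mA !mB.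
  move: (hx1 _ _ euw) (vertex_coverP _ cS _ _ euw).
  have := ltn_ord (x u); have := ltn_ord (x w).
  by case: (u \in S); case: (w \in S); rewrite ?andbT ?andbF ?orbF ?orbT //=; lia.
apply/cover_withinP; exists S'; split=> //.
  apply/subsetP => v vD'; rewrite !in_setU !in_setD !mA !mB hx2 //=.
  by case: (v \in S).
pose y : {ffun T -> 'I_3} :=
  [ffun v => if (v \in A) || (v \in B) then inord 1 else x v].
have yE v : y v = (if (v \in A) || (v \in B) then 1 else x v) :> nat.
  by rewrite ffunE; case: ifP => _ //; rewrite inordK.
(* [y] respects only [D]: a vertex of [D'] outside [S] lies in [A] and drops to the value 1/2. The
   equality of [lp D'] and [lp D] is what allows comparing [x] with [y]. *)
have hy : hcover D y.
  apply/hcoverP; split=> [u w euw|v vD]; rewrite !yE !mA !mB; last first.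
    by rewrite (subsetP sDS) // hx2 // (subsetP sDD').
  move: (hx1 _ _ euw) (vertex_coverP _ cS _ _ euw).
  have := ltn_ord (x u); have := ltn_ord (x w).
  by case: (u \in S); case: (w \in S); rewrite ?andbT ?andbF ?orbF ?orbT //=;
    do ?[case: ifP]; lia.
have := lp_le hy; rewrite -eqlp -wx => le_xy.
have eqw : weight y + #|A| = weight x + #|B|.
  rewrite -!sum_mem_card -!big_split /=; apply: eq_bigr => v _.
  rewrite yE mA mB; have := ltn_ord (x v).
  by case: (v \in S); rewrite ?andbT ?andbF ?orbF ?orbT //=; case: ifP; lia.
have leAB : #|A| <= #|B| by lia.
have sBS : B \subset S by apply/subsetP => v; rewrite mB => /andP[].
have := subset_leq_card sBS; have := cardsD S B; have := cardsU (S :\: B) A.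
by rewrite (setIidPr sBS) -/S'; lia.
Qed.

(** * Matchings of the bipartite double cover *)

(* A pair [(u, w)] of [M] joins the left copy of [u] to the right copy of
   [w]. *)
Definition dmatching D M :=
  [/\ forall u w, (u, w) \in M -> [/\ e u w, u \notin D & w \notin D],
      forall u w w', (u, w) \in M -> (u, w') \in M -> w = w' &
      forall u u' w, (u, w) \in M -> (u', w) \in M -> u = u'].

Lemma dmatching_card D M : dmatching D M -> #|M| <= #|T|.
Proof.
case=> _ f _; rewrite -(card_in_imset (f := fst) (D := M)) ?max_card //.
by move=> [u w] [u' w'] h h' /= E; move: h h'; rewrite E => h /(f _ _ _ h) ->.
Qed.

(** Weak duality in the double cover: the left copies of positive value and the right copies of
    value 1 meet every pair of [M], and a copy meets at most one pair. *)
Lemma dmatching_hcover D M x :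
  dmatching D M -> hcover D x -> 2 * #|D| + #|M| <= weight x.
Proof.
move=> [hM f g] /hcoverP[h1 h2].
pose A := [set v | (v \notin D) && (0 < x v)].
pose B := [set v | (v \notin D) && (1 < x v)].
have -> : weight x = 2 * #|D| + (#|A| + #|B|).
  rewrite -!sum_mem_card big_distrr -!big_split /=; apply: eq_bigr => v _.
  rewrite !inE.
  have := ltn_ord (x v); case: (boolP (v \in D)) => [/h2 -> //|_ /=].
  by case: (nat_of_ord (x v)) => [|[|[|]]].
rewrite leq_add2l.
have sM : M \subset [set a in M | a.1 \in A] :|: [set a in M | a.2 \in B].
  apply/subsetP => -[u w] uwM; have [euw uD wD] := hM _ _ uwM.
  rewrite !inE /= uwM uD wD /=; move: (h1 _ _ euw).
  by have := ltn_ord (x w); lia.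
apply: leq_trans (subset_leq_card sM) _.
apply: leq_trans (leq_card_setU _ _) _; apply: leq_add.
- rewrite -(card_in_imset (f := fst)).
    by apply/subset_leq_card/subsetP => v /imsetP[a]; rewrite inE => /andP[_ aA] ->.
  move=> [u w] [u' w']; rewrite !inE => /andP[h _] /andP[h' _] /= E.
  by move: h h'; rewrite E => h /(f _ _ _ h) ->.
- rewrite -(card_in_imset (f := snd)).
    by apply/subset_leq_card/subsetP => v /imsetP[a]; rewrite inE => /andP[_ aA] ->.
  move=> [u w] [u' w']; rewrite !inE => /andP[h _] /andP[h' _] /= E.
  by move: h h'; rewrite E => h /(g _ _ _ h) ->.
Qed.

Lemma dmatching_lp D M : dmatching D M -> 2 * #|D| + #|M| <= lp D.
Proof. by move=> hM; have [x hx <-] := lp_attained D; apply: dmatching_hcover. Qed.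

(* [Z] is the set of right copies reached by alternating paths from unmatched
   left copies; a left copy is reached if it is unmatched or matched into
   [Z].  Koenig's argument then gives a cover with the weight of [M]. *)
Lemma closed_lp D M (Z : {set T}) : dmatching D M ->
  (forall w, w \in Z -> w \notin D) ->
  (forall w, w \in Z -> exists u, (u, w) \in M) ->
  (forall u w, e u w -> u \notin D -> w \notin D ->
     (forall w', (u, w') \in M -> w' \in Z) -> w \in Z) ->
  lp D = 2 * #|D| + #|M|.
Proof.
move=> dM hZD hZM closedZ; apply/eqP; rewrite eqn_leq dmatching_lp // andbT.
have [hM f g] := dM.
(* [U] holds the left copies that are not reached; together with the right copies in [Z] they cover
   the double cover. An edge of the graph appears there twice, once in each direction, so the values
   at its ends add up to at least 2. *)
pose U := [set a.1 | a in M & a.2 \notin Z].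
pose x : {ffun T -> 'I_3} :=
  [ffun v => if v \in D then ord_max else inord ((v \in U) + (v \in Z))].
have xE v : x v = (if v \in D then 2 else (v \in U) + (v \in Z)) :> nat.
  by rewrite ffunE; case: ifP => // _; rewrite inordK //; case: (_ \in U); case: (_ \in Z).
have UZ u w : e u w -> u \notin D -> w \notin D -> (u \in U) || (w \in Z).
  move=> euw uD wD; case: (boolP (u \in U)) => //= uU; apply: (closedZ u) => // w' uw'M.
  by apply: contraNT uU => w'Z; apply/imsetP; exists (u, w') => //; rewrite inE uw'M.
have hx : hcover D x.
  apply/hcoverP; split=> [u w euw|v vD]; rewrite !xE ?vD //.
  have ewu : e w u by rewrite sym_e.
  case: (boolP (u \in D)) => uD //; case: (boolP (w \in D)) => wD; first by rewrite addnC.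
  by have := UZ _ _ euw uD wD; have := UZ _ _ ewu wD uD; lia.
apply: leq_trans (lp_le hx) _.
have -> : weight x = 2 * #|D| + (#|U| + #|Z|).
  rewrite -!sum_mem_card big_distrr -!big_split /=; apply: eq_bigr => v _.
  rewrite xE; case: (boolP (v \in D)) => [vD|//].
  have -> : v \in Z = false by apply: contraTF vD => /hZD.
  suff -> : v \in U = false by [].
  apply: contraTF vD => /imsetP[[u w]]; rewrite inE => /andP[/hM[]] *; by subst.
rewrite leq_add2l.
have -> : #|Z| = #|[set a in M | a.2 \in Z]|.
  rewrite -(card_in_imset (f := snd) (D := [set a in M | a.2 \in Z])).
    apply: eq_card => w; apply/idP/imsetP => [wZ|[a]]; last by rewrite inE => /andP[_ aZ] ->.
    by have [u uw] := hZM _ wZ; exists (u, w) => //; rewrite inE uw.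
  move=> [u w] [u' w']; rewrite !inE => /andP[h _] /andP[h' _] /= E.
  by move: h h'; rewrite E => h /(g _ _ _ h) ->.
apply: leq_trans (leq_add (leq_imset_card _ _) (leqnn _)) _.
rewrite addnC -cardsUI.
rewrite [X in _ + X](_ : _ = 0) ?addn0; last first.
  by apply: eq_card0 => a; rewrite !inE; case: (a.2 \in Z); rewrite /= ?andbF.
by apply/subset_leq_card/subsetP => a; rewrite !inE; case: (a \in M).
Qed.

(** * The branching step *)

Definition settle D v := if lp (v |: D) == lp D then v |: D else D.

Definition reduce D := foldl settle D (enum T).

Lemma settle_lp D v : lp (settle D v) = lp D.
Proof. by rewrite /settle; case: eqP. Qed.

Lemma settle_sub D v : D \subset settle D v.
Proof. by rewrite /settle; case: ifP => _; rewrite ?subsetUr ?subxx. Qed.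

Lemma foldl_settle_lp D r : lp (foldl settle D r) = lp D.
Proof. by elim: r D => //= v r IH D; rewrite IH settle_lp. Qed.

Lemma foldl_settle_sub D r : D \subset foldl settle D r.
Proof. by elim: r D => //= v r IH D; apply: subset_trans (settle_sub D v) (IH _). Qed.

(** A single pass suffices: a rejected vertex stays rejected, since [D] only grows afterwards, [lp]
    of the current set stays constant, and [lp] is monotone. *)
Lemma foldl_settle_gt D r v : v \in r -> v \notin foldl settle D r ->
  lp (foldl settle D r) < lp (v |: foldl settle D r).
Proof.
elim: r D => //= w r IH D; rewrite inE => /predU1P[<- {w}|vr]; last exact: IH.
move=> vF; rewrite foldl_settle_lp settle_lp.
have /negP nv : ~~ (lp (v |: D) == lp D).
  apply: contra vF => h; apply: (subsetP (foldl_settle_sub _ r)).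
  by rewrite /settle h setU11.
have le1 : lp D <= lp (v |: D) by apply: lp_mono; apply: subsetUr.
apply: (@leq_trans (lp (v |: D))); first by rewrite ltn_neqAle le1 eq_sym andbT; apply/negP.
apply/lp_mono/setUS; exact: subset_trans (settle_sub D v) (foldl_settle_sub _ _).
Qed.

Variable s : seq (T * T).
Hypothesis edges_s : forall u w, e u w = ((u, w) \in s) || ((w, u) \in s).

(** The last uncovered edge of the listing, which is what a loop that overwrites its result
    finds. *)
Definition uncovered D : option (T * T) :=
  foldl (fun r p => if (p.1 \in D) || (p.2 \in D) then r else Some p) None s.

Lemma uncoveredP D :
  match uncovered D with
  | None => vertex_cover D
  | Some p => [/\ e p.1 p.2, p.1 \notin D & p.2 \notin D]
  end.
Proof.
suff : match uncovered D with
  | None => {in s, forall p, (p.1 \in D) || (p.2 \in D)}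
  | Some p => [/\ p \in s, p.1 \notin D & p.2 \notin D]
  end.
  case: uncovered => [p [ps h1 h2]|h].
    by split=> //; rewrite edges_s -surjective_pairing ps.
  apply/vertex_coverP => u w; rewrite edges_s => /orP[/h //|/h /=]; by rewrite orbC.
rewrite /uncovered; elim/last_ind: s => //= r p; rewrite foldl_rcons /=.
case: ifP => [cp|/negbT].
  case: foldl => [q [qr h1 h2]|h]; first by rewrite mem_rcons inE qr orbT.
  by move=> q; rewrite mem_rcons inE => /predU1P[->|/h].
by rewrite negb_or => /andP[h1 h2] _; rewrite mem_rcons mem_head.
Qed.

(* The bits of [c], most significant first, say which end of an uncovered edge
   joins the cover; [W] is the power of 2 bounding [c]. *)
Definition branch W (Dc : {set T} * nat) :=
  let D := reduce Dc.1 in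
  match uncovered D with
  | None => (D, Dc.2)
  | Some p => if W <= Dc.2 + Dc.2 then (p.2 |: D, Dc.2 + Dc.2 - W)
              else (p.1 |: D, Dc.2 + Dc.2)
  end.

Lemma reduce_lp D : lp (reduce D) = lp D.
Proof. exact: foldl_settle_lp. Qed.

Lemma reduce_gt D v : v \notin reduce D -> lp (reduce D) < lp (v |: reduce D).
Proof. by apply: foldl_settle_gt; rewrite mem_enum. Qed.

Lemma reduce_cover_within D k : cover_within D k -> cover_within (reduce D) k.
Proof. exact: persistency (foldl_settle_sub _ _) (reduce_lp _). Qed.

Lemma cover_sub D D' : D \subset D' -> vertex_cover D -> vertex_cover D'.
Proof.
move=> /subsetP sDD' /vertex_coverP h; apply/vertex_coverP => u w /h /orP[]/sDD' ->;
  by rewrite ?orbT.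
Qed.

(** A cover may be complete before the fixed number of rounds is over. The remaining rounds make no
    choice, and persistency keeps the size bound. *)
Lemma branch_done W D c k r : vertex_cover D -> cover_within D k ->
  vertex_cover (iter r (branch W) (D, c)).1 && (#|(iter r (branch W) (D, c)).1| <= k).
Proof.
move=> cD wD.
suff [h1 h2] : vertex_cover (iter r (branch W) (D, c)).1 /\
               cover_within (iter r (branch W) (D, c)).1 k by rewrite h1 cover_within_card.
elim: r => //= r; case: (iter _ _ _) => {cD wD} D1 c1 [/= cD wD]; rewrite /branch /=.
have cR : vertex_cover (reduce D1) by apply: cover_sub cD; apply: foldl_settle_sub.
case: uncovered (uncoveredP (reduce D1)) => [p [ep h1 h2]|_]; last first.
  by split=> //; apply: reduce_cover_within.
by move/vertex_coverP: cR => /(_ _ _ ep); rewrite (negbTE h1) (negbTE h2).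
Qed.

(** The slack 2k - [lp D] is at most [r], and choosing the end of the uncovered edge that belongs to
    a fixed small cover uses up one unit of it. Without slack neither end can be added, so the
    reduced set already covers: this is the additional round. The factor [2 ^ (b - r)] aligns the
    [r] remaining bits with the top of [b] bits. *)
Lemma branch_complete b r D k : r <= b ->
  cover_within D k -> 2 * k <= lp D + r ->
  exists2 c, c < 2 ^ r &
    let D' := (iter r.+1 (branch (2 ^ b)) (D, c * 2 ^ (b - r))).1 in
    vertex_cover D' && (#|D'| <= k).
Proof.
elim: r D => [|r IH] D rb wD lpD; have wR := reduce_cover_within wD.
  exists 0 => //; rewrite iterSr {2}/branch /=.
  case: uncovered (uncoveredP (reduce D)) => [p [ep h1 h2]|cR]; last first.
    exact: (@branch_done _ (reduce D) 0 k 0).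
  have /cover_withinP[S [cS sS kS]] := wR.
  have /orP[uS|uS] := vertex_coverP _ cS _ _ ep.
    have := reduce_gt h1; rewrite reduce_lp => h.
    have : cover_within (p.1 |: reduce D) k.
      by apply/cover_withinP; exists S; split=> //; rewrite subUset sub1set uS.
    by move/lp_le_cover; lia.
  have := reduce_gt h2; rewrite reduce_lp => h.
  have : cover_within (p.2 |: reduce D) k.
    by apply/cover_withinP; exists S; split=> //; rewrite subUset sub1set uS.
  by move/lp_le_cover; lia.
have pb : 2 ^ (b - r) = 2 ^ (b - r.+1) + 2 ^ (b - r.+1).
  by rewrite addnn -mul2n -expnS; congr (_ ^ _); lia.
have pb2 : 2 ^ b = 2 ^ r * 2 ^ (b - r) by rewrite -expnD; congr (_ ^ _); lia.
case E: (uncovered (reduce D)) (uncoveredP (reduce D)) => [p|]; last first.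
  move=> cR; exists 0; first by rewrite expn_gt0.
  by rewrite iterSr {2}/branch [(D, _).1]/= E; apply: branch_done.
move=> [ep h1 h2]; have /cover_withinP[S [cS sS kS]] := wR.
case: (boolP (p.1 \in S)) => [uS|uS].
  have := reduce_gt h1; rewrite reduce_lp => h.
  have [||c cr hc] := IH (p.1 |: reduce D) (ltnW rb).
  - by apply/cover_withinP; exists S; split=> //; rewrite subUset sub1set uS.
  - lia.
  exists c; first by rewrite expnS; lia.
  rewrite iterSr {2}/branch [(D, _).1]/= E [(D, _).2]/=.
  rewrite -mulnDr -pb (_ : 2 ^ b <= _ = false) //.
  by rewrite pb2 leq_pmul2r ?expn_gt0 // leqNgt cr.
have uS2 : p.2 \in S by move/vertex_coverP: cS => /(_ _ _ ep); rewrite (negbTE uS).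
have := reduce_gt h2; rewrite reduce_lp => h.
have [||c cr hc] := IH (p.2 |: reduce D) (ltnW rb).
- by apply/cover_withinP; exists S; split=> //; rewrite subUset sub1set uS2.
- lia.
(* The leading bit 1: after doubling it is worth exactly [2 ^ b], which [branch] subtracts. *)
exists (2 ^ r + c); first by rewrite expnS; lia.
rewrite iterSr {2}/branch [(D, _).1]/= E [(D, _).2]/=.
rewrite -mulnDr -pb mulnDl -pb2 leq_addr addKn; exact: hc.
Qed.

End HalfIntegral.

(** * Augmenting a matching along recorded alternating paths *)

Section Augmentation.
Variables (T : finType) (e : rel T).
Implicit Types (D : {set T}) (M : {set T * T}).

(* [par w u]: the search reached the right copy of [w] from the left copy of
   [u]. *)
Inductive alternating D M (par : rel T) : nat -> T -> Prop :=
| AltStart u w : par w u -> e u w -> u \notin D -> w \notin D ->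
    (forall w', (u, w') \notin M) -> alternating D M par 0 w
| AltStep j u w w' : par w u -> e u w -> w \notin D -> (u, w') \in M ->
    alternating D M par j w' -> alternating D M par j.+1 w.

Lemma alternating_mono D M (par par' : rel T) j w :
  (forall w u, par w u -> par' w u) ->
  alternating D M par j w -> alternating D M par' j w.
Proof.
move=> h; elim=> {j w} [u w p euw uD wD f|j u w w' p euw wD uw' _ IH].
  exact: AltStart (h _ _ p) euw uD wD f.
exact: AltStep (h _ _ p) euw wD uw' IH.
Qed.

Variables (D : {set T}) (par : rel T).
Hypothesis par_fun : forall w u u', par w u -> par w u' -> u = u'.

(** Recorded parents and matching partners are unique, so the path can be traced backwards from [w]
    in only one way. *)
Lemma alternating_uniq M j j' w : dmatching e D M ->
  alternating D M par j w -> alternating D M par j' w -> j = j'.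
Proof.
move=> [_ f _] h; elim: h j' => {j w} [u w p _ _ _ nu|j u w w' p _ _ uw' _ IH] j' h.
  case: h p nu => {j' w} // j u' w w' p' _ _ uw' _ p.
  by rewrite (par_fun p p') => /(_ w'); rewrite uw'.
case: h p => {j' w} [u' w p' _ _ _ nu|j' u' w w'' p' _ _ uw'' h'] p.
  by move: (nu w'); rewrite (par_fun p' p) uw'.
by move: uw'; rewrite (par_fun p p') => /(f _ _ _ uw'') ew; subst; rewrite (IH _ h').
Qed.

(** Only the partner of [u] changes. A path of length at most [j] cannot pass through [u], for it
    would then reach [w'] with an index below [j]. *)
Lemma alternating_swap M j w u w' : dmatching e D M ->
  par w u -> (u, w') \in M -> alternating D M par j w' ->
  forall i x, i <= j -> alternating D M par i x ->
  alternating D ((u, w) |: M :\ (u, w')) par i x.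
Proof.
move=> dM p uw' hw' i x + hx; have [_ f _] := dM.
elim: hx => {i x} [u1 x p1 e1 u1D xD nu1|i u1 x x' p1 e1 xD u1x' hx' IH] ij.
  apply: AltStart p1 e1 u1D xD _ => y; rewrite !inE negb_or !negb_and.
  rewrite (negbTE (nu1 y)) !orbT andbT.
  by rewrite (_ : u1 != u) //=; apply: contraTneq uw' => <-; exact: nu1.
have uu1 : u1 != u.
  apply: contraTneq ij => eu; rewrite eu in u1x'; have ew := f _ _ _ uw' u1x'.
  by subst; rewrite (alternating_uniq dM hw' hx') ltnn.
apply: AltStep p1 e1 xD _ (IH (ltnW ij)).
by rewrite !inE u1x' !xpair_eqE (negbTE uu1).
Qed.

Lemma dmatching_add M u w : dmatching e D M -> e u w -> u \notin D -> w \notin D ->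
  (forall w', (u, w') \notin M) -> (forall u', (u', w) \notin M) ->
  dmatching e D ((u, w) |: M) /\ #|(u, w) |: M| = #|M|.+1.
Proof.
move=> [h f g] euw uD wD nu nw; split; last by rewrite cardsU1 nu.
split=> [u1 w1|u1 w1 w2|u1 u2 w1].
- by rewrite !inE => /orP[/eqP[-> ->]//|/h].
- rewrite !inE !xpair_eqE => /orP[/andP[/eqP-> /eqP->]|h1] /orP[/andP[/eqP E1 /eqP E2]|h2]; last exact: f h1 h2.
  + by rewrite ?E1 ?E2.
  + by rewrite (negbTE (nu _)) in h2.
  + by rewrite ?E1 ?E2 (negbTE (nu _)) in h1.
- rewrite !inE !xpair_eqE => /orP[/andP[/eqP-> /eqP->]|h1] /orP[/andP[/eqP E1 /eqP E2]|h2]; last exact: g h1 h2.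
  + by rewrite ?E1 ?E2.
  + by rewrite (negbTE (nw _)) in h2.
  + by rewrite ?E1 ?E2 (negbTE (nw _)) in h1.
Qed.

Lemma dmatching_sub D' M M' : M' \subset M ->
  (forall u w, (u, w) \in M' -> u \notin D' /\ w \notin D') ->
  dmatching e D M -> dmatching e D' M'.
Proof.
move=> /subsetP sM hD' [h f g]; split=> [u w uw|u w w' uw uw'|u u' w uw uw'].
- by have [euw _ _] := h _ _ (sM _ uw); have [] := hD' _ _ uw.
- exact: f (sM _ uw) (sM _ uw').
- exact: g (sM _ uw) (sM _ uw').
Qed.

(* One step of the augmentation: either the free right copy [w] gets matched
   for good, or the freeness moves on to [w']. *)
Lemma alternating_augment M j w u : dmatching e D M ->
  (forall u, (u, w) \notin M) -> par w u -> alternating D M par j w ->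
  if j is j'.+1 then
    exists w', let M' := (u, w) |: M :\ (u, w') in
      [/\ (u, w') \in M, w' != w, dmatching e D M', #|M'| = #|M| &
          (forall u', (u', w') \notin M') /\ alternating D M' par j' w']
  else [/\ forall w', (u, w') \notin M, dmatching e D ((u, w) |: M)
         & #|(u, w) |: M| = #|M|.+1].
Proof.
move=> dM nw p hw; have [h f g] := dM.
case: j w / hw p nw => [u1 w p1 e1 uD wD nu|{}j u1 w w' p1 e1 wD uw' hw'] p nw.
  have E := par_fun p p1; subst u1.
  by have [] := dmatching_add dM e1 uD wD nu nw.
have E := par_fun p p1; subst u1; exists w'.
have [euw' uD w'D] := h _ _ uw'.
have ww' : w' != w by apply: contraTneq uw' => ->; exact: nw.
have dM1 : dmatching e D (M :\ (u, w')).
  apply: dmatching_sub dM; first exact: subD1set.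
  by move=> u1 w1; rewrite !inE => /andP[_ /h[]].
have [||dM2 cM2] := dmatching_add dM1 e1 uD wD.
- move=> y; rewrite !inE negb_and negbK; case: (boolP ((u, y) \in M)); rewrite ?orbT // => uy.
  by rewrite (f _ _ _ uy uw') eqxx.
- by move=> y; rewrite !inE (negbTE (nw y)) andbF.
split=> //; first by rewrite cM2 [RHS](cardsD1 (u, w')) uw'.
split=> [u'|]; last exact: (alternating_swap dM p uw' hw' (leqnn j) hw').
rewrite !inE !xpair_eqE negb_or !negb_and ww' orbT /= eqxx orbF negbK.
by case: (boolP ((u', w') \in M)) => [/g/(_ uw') ->|]; rewrite ?eqxx ?orbT.
Qed.

Lemma alternating_parent M j w : alternating D M par j w -> exists u, par w u.
Proof. by case=> [u {}w p *|{}j u {}w w' p *]; exists u. Qed.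

(** For the test of a vertex the mere existence of a larger matching is enough; no augmentation is
    carried out there. *)
Lemma alternating_larger M j w : dmatching e D M ->
  (forall u, (u, w) \notin M) -> alternating D M par j w ->
  exists M', dmatching e D M' /\ #|M'| = #|M|.+1.
Proof.
elim: j M w => [|j IH] M w dM nw hw; have [u p] := alternating_parent hw;
  have := alternating_augment dM nw p hw.
  by case=> _ ? ?; exists ((u, w) |: M).
case=> w' [_ _ dM' <- [nw' hw']]; exact: IH dM' nw' hw'.
Qed.

End Augmentation.

(** * Testing a vertex against a maximum matching *)

Section Settle.
Variables (T : finType) (e : rel T).
Hypothesis irr_e : irreflexive e.
Variables (D : {set T}) (M : {set T * T}).
Hypothesis dM : dmatching e D M.

Definition unmatch (v : T) := [set a in M | (a.1 != v) && (a.2 != v)].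

Lemma dmatching_unmatch v : dmatching e (v |: D) (unmatch v).
Proof.
apply: dmatching_sub dM; first by apply/subsetP => a; rewrite inE => /andP[].
have [h _ _] := dM; move=> u w; rewrite !inE /= => /andP[/h[_ uD wD] /andP[uv wv]].
by rewrite !negb_or uD wD uv wv.
Qed.

Lemma unmatch_card v u w : (v, w) \in M -> (u, v) \in M -> #|M| = #|unmatch v| + 2.
Proof.
move=> vw uv; have [h f g] := dM.
have -> : unmatch v = M :\ (v, w) :\ (u, v).
  apply/setP => -[a b]; rewrite !inE /= !xpair_eqE.
  case abM: ((a, b) \in M); rewrite ?andbF // ?andbT.
  have Hw : (a == v) -> b == w by move=> /eqP E; rewrite E in abM; rewrite (f _ _ _ abM vw).
  have Hu : (b == v) -> a == u by move=> /eqP E; rewrite E in abM; rewrite (g _ _ _ abM uv).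
  by case: (a == v) Hw => [->|_] //; case: (b == v) Hu => [->|_] //; rewrite ?andbF ?andbT.
have nvu : (u, v) != (v, w).
  by apply/eqP => -[Eu _]; have [] := h _ _ uv; rewrite Eu irr_e.
rewrite (cardsD1 (v, w)) vw (cardsD1 (u, v)) !inE nvu uv.
by rewrite addnA addnC.
Qed.

Lemma unmatch_card_le v :
  (forall w, (v, w) \notin M) \/ (forall u, (u, v) \notin M) -> #|M| <= #|unmatch v| + 1.
Proof.
have [h f g] := dM; move=> hv.
have c1 (N : {set T * T}) : N \subset M ->
  {in N &, forall a b, a = b} -> #|M| <= #|M :\: N| + 1.
  move=> sN hN; rewrite -(cardsID N M) (setIidPr sN) addnC leq_add2l.
  case: (set_0Vmem N) => [->|[a aN]]; first by rewrite cards0.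
  by rewrite (cardsD1 a) aN (eq_card0 (A := N :\ a)) // => b; rewrite !inE;
    case: (boolP (b \in N)); rewrite ?andbF // => bN; rewrite (hN _ _ aN bN) eqxx.
case: hv => hv.
- apply: leq_trans (c1 [set a in M | a.2 == v] _ _) _.
  + by apply/subsetP => a; rewrite inE => /andP[].
  + move=> [a b] [a' b']; rewrite !inE /= => /andP[h1 /eqP E1] /andP[h2 /eqP E2].
    by subst; rewrite (g _ _ _ h1 h2).
  rewrite leq_add2r; apply/subset_leq_card/subsetP => -[a b]; rewrite !inE /=.
  case: (boolP ((a, b) \in M)) => //= abM; rewrite andbT => ->; rewrite andbT.
  by apply: contraTneq abM => ->; exact: hv.
- apply: leq_trans (c1 [set a in M | a.1 == v] _ _) _.
  + by apply/subsetP => a; rewrite inE => /andP[].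
  + move=> [a b] [a' b']; rewrite !inE /= => /andP[h1 /eqP E1] /andP[h2 /eqP E2].
    by subst; rewrite (f _ _ _ h1 h2).
  rewrite leq_add2r; apply/subset_leq_card/subsetP => -[a b]; rewrite !inE /=.
  case: (boolP ((a, b) \in M)) => //= abM; rewrite andbT => -> /=.
  by apply: contraTneq abM => ->; exact: hv.
Qed.

Hypothesis maxM : lp e D = 2 * #|D| + #|M|.

(** At most one pair is lost while [2 * #|D|] grows by 2, so [lp] increases, unless [v] is in [D]
    already. *)
Lemma settle_unmatched v :
  (forall w, (v, w) \notin M) \/ (forall u, (u, v) \notin M) -> settle e D v = D.
Proof.
move=> hv; rewrite /settle; case: eqP => // E.
have := dmatching_lp (dmatching_unmatch v); have := unmatch_card_le hv.
rewrite E maxM cardsU1; case: (boolP (v \in D)) => [vD _ _|_]; last by lia.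
by apply/setUidPr; rewrite sub1set.
Qed.

(** With both copies of [v] matched, the two lost pairs exactly balance the 2 contributed by [v];
    any enlargement of the remaining matching makes [lp] rise. *)
Lemma settle_larger v u w M' : (v, w) \in M -> (u, v) \in M ->
  dmatching e (v |: D) M' -> #|M'| = #|unmatch v|.+1 -> settle e D v = D.
Proof.
move=> vw uv dM' cM'; rewrite /settle; case: eqP => // E.
have [h _ _] := dM; have [_ vD _] := h _ _ vw.
by have := dmatching_lp dM'; have := unmatch_card vw uv; rewrite E maxM cardsU1 vD; lia.
Qed.

Lemma settle_tight v u w : (v, w) \in M -> (u, v) \in M ->
  lp e (v |: D) = 2 * #|v |: D| + #|unmatch v| -> settle e D v = v |: D.
Proof.
move=> vw uv E; rewrite /settle E maxM (unmatch_card vw uv) cardsU1.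
have [h _ _] := dM; have [_ -> _] := h _ _ vw.
by rewrite (_ : _ == _) //; apply/eqP; lia.
Qed.

End Settle.

(** * The annihilation number *)

Lemma set2_eq (T : finType) (a b c d : T) :
  [set a; b] = [set c; d] -> (a = c /\ b = d) \/ (a = d /\ b = c).
Proof.
move=> E.
have ha : a \in [set c; d] by rewrite -E set21.
have hb : b \in [set c; d] by rewrite -E set22.
have hc : c \in [set a; b] by rewrite E set21.
have hd : d \in [set a; b] by rewrite E set22.
move: ha hb hc hd; rewrite !inE.
by do 4![case/orP=> /eqP ?]; subst; auto.
Qed.

Lemma subset_of_card (T : finType) (X : {set T}) j :
  j <= #|X| -> exists2 A : {set T}, A \subset X & #|A| = j.
Proof.
move=> jX; exists [set v in take j (enum X)].
  by apply/subsetP => v; rewrite inE => /mem_take; rewrite mem_enum.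
rewrite cardsE (card_uniqP _) ?size_take -?cardE ?take_uniq ?enum_uniq //.
by case: ltngtP jX.
Qed.

(** The least entry [x] of [s] either occurs in [t1] and is removed there, or it occurs in [t2] and
    takes the place of the first entry of [t1], which is at least as large. *)
Lemma sumn_take_le s t1 t2 : sorted leq s -> perm_eq s (t1 ++ t2) ->
  sumn (take (size t1) s) <= sumn t1.
Proof.
elim: s t1 t2 => [|x s IH] [|y t1] t2 //= sx /permP pm.
have ss := path_sorted sx.
have /allP lex : all (leq x) s by apply: order_path_min sx; apply: leq_trans.
have pm' : perm_eq (x :: s) (y :: t1 ++ t2) by apply/permP.
case: (boolP (x \in y :: t1)) => [xt|].
  have := perm_to_rem xt => pt; have /eqP E := perm_sumn pt; rewrite /= in E.
  have := perm_size pt => /= -[Es].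
  rewrite -[y + sumn t1]/(sumn (y :: t1)) (perm_sumn pt) /= leq_add2l Es.
  apply: (IH _ t2) => //; rewrite -(perm_cons x) (permPl pm') -cat_cons.
  by rewrite -[x :: _ ++ _]cat_cons perm_cat2r.
rewrite inE negb_or => /andP[xy xt1].
have xt2 : x \in t2.
  by have := perm_mem pm' x; rewrite !inE eqxx mem_cat (negbTE xy) (negbTE xt1) /= => <-.
have ys : y \in s.
  by have := perm_mem pm' y; rewrite !inE eqxx eq_sym (negbTE xy) /= => ->.
apply: leq_add (lex _ ys) _; apply: (IH _ (y :: rem x t2)) => //.
rewrite -(perm_cons x) (permPl pm').
apply/permP => p; have /permP/(_ p) /= E := perm_to_rem xt2.
by rewrite /= !count_cat /= E; lia.
Qed.

Section Degrees.
Variables (T : finType) (e : rel T).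
Hypothesis sym_e : symmetric e.

Implicit Types (A B : {set T}).

Let dsum (A : {set T}) := \sum_(v in A) degree e v.

(** By maximality of the annihilation number even the [#|W|] least degrees sum to more than the
    number of edges. *)
Lemma degree_sum_gt (W : {set T}) : annihilation_number e < #|W| ->
  num_edges e < \sum_(v in W) degree e v.
Proof.
move=> aW.
have lt : num_edges e < sumn (take #|W| (degree_seq e)).
  rewrite ltnNge; apply: contraL aW => h; rewrite -leqNgt /annihilation_number.
  case: (posnP #|W|) => [->//|W0].
  by apply: (@leq_bigmax_seq _ _ _ id); rewrite // mem_index_iota W0 ltnS max_card.
apply: leq_trans lt _.
have -> : \sum_(v in W) degree e v = sumn [seq degree e v | v <- enum W].
  by rewrite sumnE big_map big_enum.
have -> : #|W| = size [seq degree e v | v <- enum W] by rewrite size_map -cardE.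
apply: (sumn_take_le (t2 := [seq degree e v | v <- enum (~: W)])).
  by apply: sort_sorted; apply: leq_total.
rewrite perm_sort -map_cat; apply: perm_map; apply: uniq_perm.
- exact: enum_uniq.
- rewrite cat_uniq !enum_uniq andbT /=; apply/hasPn => v; rewrite !mem_enum.
  by rewrite inE.
- by move=> v; rewrite mem_cat !mem_enum !inE orbN.
Qed.

Lemma annihilation_le : annihilation_number e <= #|T|.
Proof.
by apply/bigmax_leqP_seq => i; rewrite mem_index_iota => /andP[_].
Qed.

(** Ordered pairs are counted, so in a simple graph [cross A A] is twice the number of edges inside
    [A]. *)
Let cross (A B : {set T}) := \sum_(u in A) \sum_(w in B) (e u w : nat).

Lemma degreeE v : degree e v = \sum_w (e v w : nat).
Proof. by rewrite /degree -sum_mem_card; apply: eq_bigr => w _; rewrite inE. Qed.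

Let cross_sym A B : cross A B = cross B A.
Proof.
rewrite /cross exchange_big /=; apply: eq_bigr => w _; apply: eq_bigr => u _.
by rewrite sym_e.
Qed.

Let dsumE A B : dsum A = cross A B + cross A (~: B).
Proof.
rewrite -big_split /=; apply: eq_bigr => u _; rewrite degreeE (bigID (mem B)) /=.
by congr (_ + _); apply: eq_bigl => w; rewrite inE.
Qed.

Let dsumD A B : B \subset A -> dsum A = dsum B + dsum (A :\: B).
Proof. by move=> sBA; rewrite /dsum (big_setID B) /= (setIidPr sBA). Qed.

Let dsumU A B : [disjoint A & B] -> dsum (A :|: B) = dsum A + dsum B.
Proof.
rewrite disjoint_sym => /setDidPl dAB.
by rewrite (dsumD (subsetUl A B)) setDUl setDv set0U dAB. Qed.

Let dsumS A B : B \subset A -> dsum B <= dsum A.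
Proof. by move/dsumD ->; rewrite leq_addr. Qed.

Let crossSl A A' B : A' \subset A -> cross A' B <= cross A B.
Proof. by move=> sA; rewrite /cross [leqRHS](big_setID A') /= (setIidPr sA) leq_addr. Qed.

Hypothesis handshake : \sum_v degree e v = 2 * num_edges e.

Section Gap.
Variables (l : nat) (S : {set T}).
Hypothesis indepS : forall u w, u \in S -> w \in S -> ~~ e u w.
Hypothesis cardS : annihilation_number e <= #|S| + l.

(* If the claim fails, some [P] and [Q] in [X], disjoint with [l.+1] elements
   each and [P] of smaller degree sum, satisfy: replacing [Y] by [X :\: Q] in
   [S], or adding [P] to [S], gives more than [annihilation_number e] vertices.
   Both degree sums exceed the number of edges, which bounds the degree sum of
   [Q] above and that of [P] below, by the number of edges inside [~: S]. *)
Lemma hall_deficiency (X Y : {set T}) : X \subset ~: S -> Y \subset S ->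
  (forall u w, u \in X -> w \in S -> e u w -> w \in Y) ->
  #|X| <= #|Y| + (2 * l + 1).
Proof.
move=> sXS sYS hXY; rewrite leqNgt; apply/negP => gtX.
have [A0 sA0 cA0] : exists2 A : {set T}, A \subset X & #|A| = l.+1.
  by apply: subset_of_card; lia.
pose pr (A : {set T}) := (A \subset X) && (#|A| == l.+1).
have prA0 : pr A0 by rewrite /pr sA0 cA0 eqxx.
case: (arg_minnP dsum prA0) => P /andP[sPX /eqP cP] minP.
have cXP : #|X :\: P| = #|X| - l.+1 by rewrite cardsD (setIidPr sPX) cP.
(* This size makes the exchange of [Y] for [X :\: Q] enlarge [S] by exactly [l.+1]. It is at least
   [l.+1] and may be larger; the minimality of [P] is applied to a part [Q'] of [Q]. *)
have [Q sQ cQ] : exists2 Q : {set T}, Q \subset X :\: P & #|Q| = #|X| - #|Y| - l.+1.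
  by apply: subset_of_card; rewrite cXP; lia.
have [Q' sQ' cQ'] : exists2 Q' : {set T}, Q' \subset Q & #|Q'| = l.+1.
  by apply: subset_of_card; rewrite cQ; lia.
have sQX : Q \subset X := subset_trans sQ (subsetDl _ _).
have lePQ : dsum P <= dsum Q.
  apply: leq_trans (dsumS sQ'); apply: minP.
  by rewrite /pr cQ' eqxx (subset_trans sQ').
have sPS : [disjoint S & P].
  by rewrite disjoint_sym disjoints_subset (subset_trans sPX).
have cSP : #|S :|: P| = #|S| + l.+1.
  by rewrite -cP cardsU (disjoint_setI0 sPS) cards0 subn0.
have lt1 : num_edges e < dsum (S :|: P).
  by apply: degree_sum_gt; rewrite cSP; move: cardS; clear; lia.
have dSX : [disjoint S :\: Y & X :\: Q].
  rewrite disjoint_sym disjoints_subset; apply/subsetP => v.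
  rewrite !inE => /andP[_ /(subsetP sXS)]; by rewrite inE => /negbTE ->; rewrite andbF.
have cYS := subset_leq_card sYS.
have cQX := subset_leq_card sQX.
have lt2 : num_edges e < dsum ((S :\: Y) :|: (X :\: Q)).
  apply: degree_sum_gt; rewrite cardsU (disjoint_setI0 dSX) cards0 subn0.
  rewrite !cardsD (setIidPr sYS) (setIidPr sQX) cQ.
  by move: cYS cQX gtX cardS; clear; lia.
rewrite dsumU // in lt1; rewrite dsumU // in lt2.
have SS0 : cross S S = 0.
  by rewrite /cross big1 // => u uS; rewrite big1 // => w wS; rewrite (negbTE (indepS uS wS)).
have dS : dsum S = cross S (~: S) by rewrite (dsumE S S) SS0.
have dT : dsum (~: S) = cross S (~: S) + cross (~: S) (~: S).
  by rewrite (dsumE _ S) cross_sym.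
have tot : dsum S + dsum (~: S) = 2 * num_edges e.
  rewrite -handshake /dsum [RHS](bigID (mem S)) /=; congr (_ + _).
  by apply: eq_bigl => v; rewrite inE.
have dX : dsum X = cross X S + cross X (~: S) := dsumE X S.
have leX : cross X (~: S) <= cross (~: S) (~: S) := crossSl _ sXS.
have leXS : cross X S <= dsum Y.
  rewrite (dsumE Y X) (cross_sym Y X); apply: leq_trans (leq_addr _ _).
  apply: leq_sum => u uX; rewrite [leqRHS]big_mkcond [leqLHS]big_mkcond /=.
  apply: leq_sum => w _; case: ifP => // wS; case: ifP => // wY.
  by case euw: (e u w); rewrite // (hXY u w uX wS euw) in wY.
have := dsumD sYS; have := dsumD sQX.
by move: lePQ lt1 lt2 dS dT tot dX leX leXS; clear; lia.
Qed.

End Gap.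

(** A vertex outside [S] of value 0 has only neighbours of value 1 in [S], and one of value below 1
    only neighbours of positive value: two instances of [hall_deficiency]. [S] is cut down to
    exactly [#|T| - k] vertices so that its complement has [k]. *)
Lemma lp_gap l k : k + annihilation_number e <= #|T| + l -> k <= #|T| ->
  cover_within e set0 k -> 2 * k <= lp e set0 + (4 * l + 2).
Proof.
move=> hk kT /cover_withinP[S0 [cS0 _ kS0]].
have [S sS cS] : exists2 S : {set T}, S \subset ~: S0 & #|S| = #|T| - k.
  by apply: subset_of_card; rewrite -(cardsC S0); lia.
have indepS u w : u \in S -> w \in S -> ~~ e u w.
  move=> /(subsetP sS) uS /(subsetP sS) wS; rewrite !inE in uS wS.
  by apply/negP => /(vertex_coverP _ _ cS0); rewrite (negbTE uS) (negbTE wS).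
have aS : annihilation_number e <= #|S| + l by rewrite cS; move: hk kT; clear; lia.
have [x hx <-] := lp_attained e set0; have [hx1 _] := hcoverP _ _ _ hx.
pose X1 := [set v | (v \notin S) && (x v == 0 :> nat)].
pose X2 := [set v | (v \notin S) && (x v < 2)].
pose Y1 := [set v | (v \in S) && (x v == 2 :> nat)].
pose Y2 := [set v | (v \in S) && (0 < x v)].
(* A doubled value is the indicator of being positive plus that of being 2. Inside [S] these are
   counted by [Y2] and [Y1]; outside, [X1] and [X2] count what is missing to 2. *)
have sum_eq : #|X1| + #|X2| + weight x = 2 * #|~: S| + (#|Y1| + #|Y2|).
  rewrite -!sum_mem_card big_distrr -!big_split /=; apply: eq_bigr => v _.
  rewrite !inE; case: (v \in S) => //=; have := ltn_ord (x v);
    by case: (nat_of_ord (x v)) => [|[|[|]]].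
have sX1 : X1 \subset ~: S by apply/subsetP => v; rewrite !inE => /andP[].
have sX2 : X2 \subset ~: S by apply/subsetP => v; rewrite !inE => /andP[].
have sY1 : Y1 \subset S by apply/subsetP => v; rewrite !inE => /andP[].
have sY2 : Y2 \subset S by apply/subsetP => v; rewrite !inE => /andP[].
have le1 : #|X1| <= #|Y1| + (2 * l + 1).
  apply: hall_deficiency sX1 sY1 _ => // u w; rewrite !inE => /andP[_ /eqP xu] wS /hx1.
  by rewrite xu wS; have := ltn_ord (x w); lia.
have le2 : #|X2| <= #|Y2| + (2 * l + 1).
  apply: hall_deficiency sX2 sY2 _ => // u w; rewrite !inE => /andP[_ xu] wS /hx1.
  by rewrite wS /=; lia.
have cC : #|~: S| = k by rewrite cardsCs setCK cS subKn.
by move: sum_eq; rewrite cC; lia.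
Qed.
End Degrees.

(** * Degrees and the handshake identity from an edge listing *)

Section Listing.
Variables (T : finType) (e : rel T) (s : seq (T * T)).
Hypotheses (sym_e : symmetric e) (irr_e : irreflexive e).
Hypothesis list_s : edge_listing e s.

Lemma num_edges_listing : num_edges e = size s.
Proof. by rewrite /num_edges cardE -(perm_size list_s) size_map. Qed.

Lemma mem_edges u w : ([set u; w] \in edges e) = e u w.
Proof.
apply/imsetP/idP => [[p]|euw]; last by exists (u, w).
rewrite inE => ep /set2_eq[[-> ->]|[-> ->]] //; by rewrite sym_e.
Qed.

Lemma edge_listingE u w : e u w = ((u, w) \in s) || ((w, u) \in s).
Proof.
rewrite -mem_edges -mem_enum -(perm_mem list_s); apply/mapP/orP.
  by case=> -[a b] ps /= /set2_eq[[-> ->]|[-> ->]]; auto.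
by case=> ps; [exists (u, w)|exists (w, u)] => //=; rewrite setUC.
Qed.

(** This is the count made by one pass over the listing; the ends of an edge being distinct, each
    edge at [v] contributes exactly 1. *)
Lemma degree_listing v :
  degree e v = \sum_(p <- s) ((p.1 == v) + (p.2 == v)).
Proof.
have -> : degree e v = count (fun E : {set T} => v \in E) (enum (edges e)).
  rewrite /degree -(card_imset (f := fun w => [set v; w])).
    rewrite -size_filter cardE; apply: perm_size; apply: uniq_perm.
    - exact: enum_uniq.
    - by rewrite filter_uniq ?enum_uniq.
    - move=> E; rewrite mem_enum mem_filter.
      rewrite mem_enum; apply/imsetP/andP.
        by case=> w; rewrite inE => evw ->; rewrite mem_edges set21.
      case=> vE /imsetP[p]; rewrite inE => ep EE; move: vE; rewrite EE !inE.
      case/orP=> /eqP ->; first by exists p.2; rewrite ?inE.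
      by exists p.1; rewrite ?inE 1?setUC // sym_e.
  by move=> w w' /set2_eq[[_ ->]|[-> ->]].
rewrite -(permP list_s) count_map -sum1_count big_mkcond /=.
apply: eq_big_seq => p ps; have : e p.1 p.2 by rewrite edge_listingE -surjective_pairing ps.
rewrite !inE ![v == _]eq_sym; case: (eqVneq p.1 v) => [->|_] /=; last by case: (p.2 == v).
by case: eqP => // ->; rewrite irr_e.
Qed.

Lemma handshake_listing : \sum_v degree e v = 2 * num_edges e.
Proof.
under eq_bigr do rewrite degree_listing.
have one (u : T) : \sum_v ((u == v) : nat) = 1.
  by rewrite (bigD1 u) //= eqxx big1 // => v; rewrite eq_sym => /negbTE ->.
rewrite exchange_big /= num_edges_listing -sum1_size big_distrr /=.
by apply: eq_bigr => p _; rewrite big_split /= !one.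
Qed.

End Listing.

(** * Greedy computation of the annihilation number *)

Definition greedy m (r : nat * nat) d :=
  if r.2 + d <= m then (r.1.+1, r.2 + d) else r.

(** No early exit is needed: in sorted order, once an entry does not fit, no later one fits, so the
    entries taken form a prefix. *)
Lemma greedy_spec m s : sorted leq s ->
  let r := foldl (greedy m) (0, 0) s in
  [/\ r.1 <= size s, r.2 = sumn (take r.1 s), r.2 <= m
    & forall j, j <= size s -> sumn (take j s) <= m -> j <= r.1].
Proof.
elim/last_ind: s => [|s d IH] sd /=; first by split=> // -[].
have ss : sorted leq s.
  by move: sd; rewrite -cats1 => /cat_sorted2[].
rewrite foldl_rcons size_rcons; have [] := IH ss.
case: (foldl _ _ s) => a c /= le_a eq_c le_c max_a.
have lastd x : x \in s -> x <= d.
  move=> xs; move: sd; rewrite -rev_sorted rev_rcons /= => /order_path_min.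
  by move=> /(_ (fun _ _ _ h1 h2 => leq_trans h2 h1))/allP; apply; rewrite mem_rev.
have full : c + d <= m -> a = size s.
  move=> le_cd; apply/eqP; rewrite eqn_leq le_a /= leqNgt; apply/negP => lt_a.
  have := max_a a.+1 lt_a; rewrite (take_nth 0) // sumn_rcons -eq_c ltnn => h.
  suff : false by []. apply: h; apply: leq_trans le_cd; rewrite leq_add2l.
  exact/lastd/mem_nth.
rewrite /greedy /=; case: ifP => [le_cd|gt_cd] /=.
  rewrite {}(full le_cd) in eq_c le_a max_a *; split=> //.
  - by rewrite take_oversize ?size_rcons // sumn_rcons eq_c take_size.
split=> //; first exact: leqW.
  by rewrite -cats1 takel_cat.
move=> j; rewrite leq_eqVlt ltnS => /predU1P[->|js].
  rewrite take_oversize ?size_rcons // sumn_rcons => le_s.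
  have sa : size s <= a by apply: max_a; rewrite // take_size; lia.
  suff : c + d <= m by rewrite gt_cd.
  by rewrite eq_c take_oversize.
by rewrite -cats1 takel_cat //; apply: max_a.
Qed.

Lemma filter_ltnS s k : sorted leq s ->
  [seq d <- s | d < k.+1] = [seq d <- s | d < k] ++ nseq (count_mem k s) k.
Proof.
elim: s => //= x s IH sx; rewrite (IH (path_sorted sx)) ltnS leq_eqVlt.
have /allP lex : all (leq x) s by apply: order_path_min sx; apply: leq_trans.
case: (eqVneq x k) => [E|nE] /=; last by case: ifP.
rewrite E ltnn (_ : [seq d <- s | d < k] = [::]) //.
apply/eqP; rewrite -(negbK (_ == _)) -has_filter; apply/hasPn => y /lex.
by rewrite E -leqNgt.
Qed.

(** Sorting is replaced by one pass over the vertices for each possible degree [t], in the manner of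
    a counting sort. The values below [#|T|] suffice because no vertex is adjacent to itself. *)
Lemma greedy_annihilation (T : finType) (e : rel T) m :
  irreflexive e -> num_edges e = m -> 0 < #|T| ->
  (foldl (fun r t => foldl (fun r v => if degree e v == t then greedy m r t else r)
     r (enum T)) (0, 0) (iota 0 #|T|)).1 = annihilation_number e.
Proof.
move=> irr_e <- T0; set f := (X in foldl X).
have fE r t : f r t = foldl (greedy (num_edges e)) r (nseq (count_mem t (degree_seq e)) t).
  rewrite /f /degree_seq (permP (permEl (perm_sort _ _)) _).
  rewrite -[[seq _ | v : T]]/[seq degree e v | v <- enum T].
  elim: (enum T) r => //= v q IH r; rewrite IH.
  by case: eqP.
have sd : sorted leq (degree_seq e) by apply: sort_sorted; apply: leq_total.
have iE k : foldl f (0, 0) (iota 0 k) =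
    foldl (greedy (num_edges e)) (0, 0) [seq d <- degree_seq e | d < k].
  elim: k => [|k IH]; first by rewrite (eq_filter (a2 := pred0)) ?filter_pred0.
  by rewrite -addn1 iotaD foldl_cat IH /= addn1 filter_ltnS // foldl_cat fE.
rewrite iE (_ : [seq d <- _ | _] = degree_seq e); last first.
  apply/all_filterP/allP => d; rewrite mem_sort => /mapP[v _ ->].
  rewrite /degree -[X in _ < X]cardsT; apply: proper_card; rewrite properE subsetT /=.
  by apply/subsetPn; exists v; rewrite ?inE // irr_e.
have sz : size (degree_seq e) = #|T| by rewrite size_sort size_map -cardE.
have [] := greedy_spec (num_edges e) sd; case: (foldl _ _ _) => a c /=; rewrite sz.
move=> le_a eq_c le_c max_a; apply/eqP; rewrite eqn_leq; apply/andP; split.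
  case: (posnP a) => [->//|a0].
  by apply: (@leq_bigmax_seq _ _ _ id); rewrite ?mem_index_iota ?a0 //= -eq_c.
by apply/bigmax_leqP_seq => i; rewrite mem_index_iota => /andP[_]; apply: max_a.
Qed.

Lemma independence_cover (T : finType) (e : rel T) k : k <= #|T| ->
  (#|T| - k <= independence_number e) = cover_within e set0 k.
Proof.
move=> kT; apply/idP/cover_withinP => [|[S [cS _ kS]]].
  have [|S iS ES] := @eq_bigmax_cond _ (independent e) (fun S => #|S|).
    apply/card_gt0P; exists set0; rewrite unfold_in; apply/forall_inP => u.
    by rewrite inE.
  rewrite [independence_number e]ES => h; exists (~: S); split; rewrite ?sub0set //; last by have := cardsC S; lia.
  apply/vertex_coverP => u w euw; rewrite !inE -negb_and; apply/negP => /andP[uS wS].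
  by have /forall_inP/(_ _ uS)/forall_inP/(_ _ wS) := iS; rewrite euw.
have iS : independent e (~: S).
  apply/forall_inP => u uS; apply/forall_inP => w wS; apply/negP.
  by move/(vertex_coverP _ _ cS); rewrite !inE in uS wS; rewrite (negbTE uS) (negbTE wS).
by apply: leq_trans (leq_bigmax_cond _ iS); have := cardsC S; lia.
Qed.

(** * Programs with counting loops *)

(* [PFor i b p] runs [p] with register [i] counting up from 0 to below the
   value of register [b]; [PSto j x y] writes field [j] of the record number
   [x] of an array of records of four cells, starting at the address held by
   register 4. *)
Inductive prog : Type :=
| PSkip
| PAsg of nat & expr
| PSto of nat & expr & expr
| PSeq of prog & prog
| PIf of expr & prog & prog
| PFor of nat & nat & prog.

Notation "p ;; q" := (PSeq p q) (at level 61, right associativity).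

(** Multiplication by 4 is spelled out in additions, the only way the machine offers. *)
Definition addr j x := Add (Reg 4) (Add (Const j) (Add (Add x x) (Add x x))).
Definition At j x := Defs.Mem (addr j x).

Definition adr b j v := b + (j + ((v + v) + (v + v))).
Definition fld st j v := memory st (adr (regs st 4) j v).
Arguments adr : simpl never.
Arguments fld : simpl never.
Arguments addr : simpl never.
Arguments At : simpl never.

Fixpoint compile p : program :=
  match p with
  | PSkip => Skip
  | PAsg r x => Assign r x
  | PSto j x y => Store (addr j x) y
  | PSeq p q => Seq (compile p) (compile q)
  | PIf x p q => If x (compile p) (compile q)
  | PFor i b p => Seq (Assign i (Const 0))
      (While (Defs.Sub (Reg b) (Reg i))
         (Seq (compile p) (Assign i (Add (Reg i) (Const 1)))))
  end.

(** A loop runs a number of times known on entry, so programs denote total functions, and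
    correctness can be proved apart from running time. *)
Fixpoint sem p st : state :=
  match p with
  | PSkip => st
  | PAsg r x => set_reg st r (eval st x)
  | PSto j x y => set_mem st (eval st (addr j x)) (eval st y)
  | PSeq p q => sem q (sem p st)
  | PIf x p q => if eval st x != 0 then sem p st else sem q st
  | PFor i b p => iteri (regs st b) (fun k st' => set_reg (sem p st') i k.+1)
                    (set_reg st i 0)
  end.

Fixpoint mods p : seq nat :=
  match p with
  | PSkip | PSto _ _ _ => [::]
  | PAsg r _ => [:: r]
  | PSeq p q | PIf _ p q => mods p ++ mods q
  | PFor i _ p => i :: mods p
  end.

Fixpoint bounds p : seq nat :=
  match p with
  | PSkip | PSto _ _ _ | PAsg _ _ => [::]
  | PSeq p q | PIf _ p q => bounds p ++ bounds q
  | PFor _ b p => b :: bounds p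
  end.

Fixpoint stores p : seq nat :=
  match p with
  | PSkip | PAsg _ _ => [::]
  | PSto j _ _ => [:: j]
  | PSeq p q | PIf _ p q => stores p ++ stores q
  | PFor _ _ p => stores p
  end.

Fixpoint counters_ok p : bool :=
  match p with
  | PSkip | PSto _ _ _ | PAsg _ _ => true
  | PSeq p q | PIf _ p q => counters_ok p && counters_ok q
  | PFor i _ p => (i \notin mods p) && counters_ok p
  end.

(** No loop bound changes anywhere in the program, so that [time_bound] can read all of them off the
    initial registers. *)
Definition bounds_ok p := all (fun b => b \notin mods p) (bounds p).

(** For a loop, 8 is the cost of a successful test (4) and of the increment (4); 6 is that of the
    initialization (2) and of the failing test (4). *)
Fixpoint time_bound (rho : nat -> nat) p : nat :=
  match p with
  | PSkip => 1
  | PAsg _ x => (eval_cost x).+1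
  | PSto j x y => (eval_cost (addr j x) + eval_cost y).+1
  | PSeq p q => time_bound rho p + time_bound rho q
  | PIf x p q => (eval_cost x + maxn (time_bound rho p) (time_bound rho q)).+1
  | PFor _ b p => rho b * (time_bound rho p + 8) + 6
  end.

Lemma eq_time_bound rho rho' p : {in bounds p, rho =1 rho'} ->
  time_bound rho p = time_bound rho' p.
Proof.
elim: p => //= [p IHp q IHq|x p IHp q IHq|i b p IHp] h.
- by rewrite IHp ?IHq // => r rb; apply: h; rewrite mem_cat rb ?orbT.
- by rewrite IHp ?IHq // => r rb; apply: h; rewrite mem_cat rb ?orbT.
- by rewrite IHp ?h ?mem_head // => r rb; apply: h; rewrite inE rb orbT.
Qed.

Lemma sem_regs p st r : r \notin mods p -> regs (sem p st) r = regs st r.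
Proof.
elim: p st => //= [r' x|p IHp q IHq|x p IHp q IHq|i b p IHp] st.
- by rewrite inE => /negbTE ->.
- by rewrite mem_cat negb_or => /andP[hp hq]; rewrite IHq ?IHp.
- by rewrite mem_cat negb_or => /andP[hp hq]; case: ifP => _; [exact: IHp|exact: IHq].
- rewrite inE negb_or => /andP[/negbTE ri rp].
  by elim: (regs st b) => /= [|k IH]; rewrite ri ?IHp.
Qed.

Lemma exec_compile p st : counters_ok p -> bounds_ok p ->
  exists t, exec (compile p) st t (sem p st) /\ t <= time_bound (regs st) p.
Proof.
rewrite /bounds_ok; elim: p st => /= [|r x|j x y|p IHp q IHq|x p IHp q IHq|i b p IHp] st.
- by exists 1; split=> //; apply: ExecSkip.
- by exists (eval_cost x).+1; split=> //; apply: ExecAssign.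
- by exists (eval_cost (addr j x) + eval_cost y).+1; split=> //; apply: ExecStore.
- case/andP=> cp cq; rewrite all_cat => /andP[/allP bp /allP bq].
  have [t1 [e1 l1]] : exists t, exec (compile p) st t (sem p st) /\
      t <= time_bound (regs st) p.
    apply: IHp cp _; apply/allP => r /bp; by rewrite mem_cat negb_or => /andP[].
  have [t2 [e2 l2]] : exists t, exec (compile q) (sem p st) t (sem q (sem p st)) /\
      t <= time_bound (regs (sem p st)) q.
    apply: IHq cq _; apply/allP => r /bq; by rewrite mem_cat negb_or => /andP[].
  exists (t1 + t2); split; first exact: ExecSeq e1 e2.
  apply: leq_add l1 _; apply: leq_trans l2 _; rewrite (@eq_time_bound _ (regs st)) //.
  by move=> r /bq; rewrite mem_cat negb_or => /andP[rp _]; rewrite sem_regs.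
- case/andP=> cp cq; rewrite all_cat => /andP[/allP bp /allP bq].
  case: ifPn => [x1|/negPn/eqP x0].
    have [|t [et lt]] := IHp st cp.
      apply/allP => r /bp; by rewrite mem_cat negb_or => /andP[].
    exists (eval_cost x + t).+1; split; first exact: ExecIfTrue.
    by rewrite ltnS leq_add2l leq_max lt.
  have [|t [et lt]] := IHq st cq.
    apply/allP => r /bq; by rewrite mem_cat negb_or => /andP[].
  exists (eval_cost x + t).+1; split; first exact: ExecIfFalse.
  by rewrite ltnS leq_add2l leq_max lt orbT.
- case/andP=> ip cp /andP[]; rewrite inE negb_or => /andP[bi bp] /allP bb.
  set N := regs st b; set f := (fun k st' => set_reg (sem p st') i k.+1); set B := time_bound _ p.
  pose stk k := iteri k f (set_reg st i 0).
  have stk_i k : regs (stk k) i = k by case: k => [|k] /=; rewrite eqxx.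
  have stk_r k r : r \notin i :: mods p -> regs (stk k) r = regs st r.
    rewrite inE negb_or => /andP[/negbTE ri rp].
    by elim: k => /= [|k IH]; rewrite ri ?sem_regs.
  have stk_b k : regs (stk k) b = N by rewrite stk_r // inE negb_or bi.
  have body k : exists t, exec (Seq (compile p) (Assign i (Add (Reg i) (Const 1))))
      (stk k) t (stk k.+1) /\ t <= B + 4.
    have [|t [et lt]] := IHp (stk k) cp.
      apply/allP => r rb; have := bb _ rb; by rewrite inE negb_or => /andP[].
    exists (t + 4); split.
      apply: ExecSeq et _.
      have -> : stk k.+1 = set_reg (sem p (stk k)) i
          (eval (sem p (stk k)) (Add (Reg i) (Const 1))).
        by rewrite /= sem_regs // stk_i addn1.
      exact: ExecAssign.
    rewrite leq_add2r; apply: leq_trans lt _; rewrite /B (@eq_time_bound _ (regs st)) //.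
    by move=> r /bb/stk_r.
  have loop d : forall k, k + d = N -> exists t,
      exec (While (Defs.Sub (Reg b) (Reg i))
              (Seq (compile p) (Assign i (Add (Reg i) (Const 1)))))
        (stk k) t (stk N) /\ t <= d * (B + 8) + 4.
    elim: d => [|d IH] k kd.
      exists 4; split=> //; rewrite -kd addn0.
      by apply: ExecWhileFalse; rewrite /= stk_b stk_i; lia.
    have [t1 [e1 l1]] := body k; have [|t2 [e2 l2]] := IH k.+1; first by lia.
    exists (3 + t1 + t2).+1; split; last by rewrite mulSn; lia.
    by apply: ExecWhileTrue e1 e2; rewrite /= stk_b stk_i; lia.
  have [t [et lt]] := loop N 0 erefl; exists (2 + t); split; last by lia.
  exact: ExecSeq (ExecAssign st i (Const 0)) et.
Qed.

Lemma adr_inj b j j' v v' : j < 4 -> j' < 4 ->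
  (adr b j v == adr b j' v') = (j == j') && (v == v').
Proof. by rewrite /adr => *; apply/eqP/andP => [|[/eqP-> /eqP->] //]; lia. Qed.

Lemma fld_store st j v x j' v' : j < 4 -> j' < 4 ->
  fld (set_mem st (adr (regs st 4) j v) x) j' v' =
  if (j' == j) && (v' == v) then x else fld st j' v'.
Proof. by move=> h h'; rewrite /fld /= adr_inj. Qed.

Lemma fld_set_reg st r v j x : r != 4 -> fld (set_reg st r v) j x = fld st j x.
Proof. by rewrite /fld /= eq_sym => /negbTE ->. Qed.

Lemma eval_At st j x : eval st (At j x) = fld st j (eval st x).
Proof. by []. Qed.

Lemma eval_addr st j x : eval st (addr j x) = adr (regs st 4) j (eval st x).
Proof. by []. Qed.

Lemma sem_seq p q st : sem (p ;; q) st = sem q (sem p st).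
Proof. by []. Qed.

Lemma sem_then st x p q : eval st x != 0 -> sem (PIf x p q) st = sem p st.
Proof. by move=> /= ->. Qed.

Lemma sem_else st x p q : eval st x = 0 -> sem (PIf x p q) st = sem q st.
Proof. by move=> /= ->. Qed.

(** * Frame and invariant rules *)

Definition frame_ok p := (4 \notin mods p) && all (fun j => j < 4) (stores p).

Definition frame p st st' :=
  [/\ forall r, r \notin mods p -> regs st' r = regs st r,
      forall a, a < regs st 4 -> memory st' a = memory st a &
      forall j v, j < 4 -> j \notin stores p -> fld st' j v = fld st j v].

Lemma sem_frame p st : frame_ok p -> frame p st (sem p st).
Proof.
rewrite /frame_ok => /andP[m4 s4]; split=> [r|a|j v]; first exact: sem_regs.
- elim: p st m4 s4 => //= [j x y|p IHp q IHq|x p IHp q IHq|i b p IHp] st.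
  + by case: eqP => //; lia.
  + rewrite mem_cat negb_or all_cat => /andP[p4 q4] /andP[sp sq] a4.
    by rewrite IHq ?IHp // sem_regs.
  + rewrite mem_cat negb_or all_cat => /andP[p4 q4] /andP[sp sq] a4.
    by case: ifP => _; rewrite ?IHp ?IHq.
  + rewrite inE negb_or => /andP[i4 p4] sp a4.
    elim: (regs st b) => //= k IH; rewrite IHp // -[regs (iteri _ _ _) 4]/(regs _ 4).
    by elim: k {IH} => /= [|k IH]; rewrite (negbTE i4) ?sem_regs.
- elim: p st m4 s4 => //= [r x|i x y|p IHp q IHq|x p IHp q IHq|i b p IHp] st.
  + by rewrite inE => r4 *; rewrite /fld /= (negbTE r4).
  + rewrite andbT inE => _ i4 j4 ji.
    by have := @fld_store st i (eval st x) (eval st y) j v i4 j4; rewrite (negbTE ji).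
  + rewrite !mem_cat !negb_or all_cat => /andP[p4 q4] /andP[sp sq] j4 /andP[jp jq].
    by rewrite IHq ?IHp.
  + rewrite !mem_cat !negb_or all_cat => /andP[p4 q4] /andP[sp sq] j4 /andP[jp jq].
    by case: ifP => _; rewrite ?IHp ?IHq.
  + rewrite inE negb_or => /andP[i4 p4] sp j4 jp.
    have fs st' x : fld (set_reg st' i x) j v = fld st' j v by rewrite /fld /= (negbTE i4).
    by elim: (regs st b) => /= [|k IH]; rewrite fs ?IHp.
Qed.

(* Thanks to the frame hypothesis of the step, the invariant need not mention
   what the loop does not write. *)
Lemma sem_for (I : nat -> state -> Prop) i b p st : frame_ok (PFor i b p) ->
  I 0 (set_reg st i 0) ->
  (forall k st', k < regs st b -> regs st' i = k -> frame (PFor i b p) st st' ->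
     I k st' -> I k.+1 (set_reg (sem p st') i k.+1)) ->
  I (regs st b) (sem (PFor i b p) st).
Proof.
move=> fok I0 IS /=; set f := (fun k st' => set_reg (sem p st') i k.+1).
suff [] : [/\ I (regs st b) (iteri (regs st b) f (set_reg st i 0)),
    regs (iteri (regs st b) f (set_reg st i 0)) i = regs st b &
    frame (PFor i b p) st (iteri (regs st b) f (set_reg st i 0))] by [].
have fstep st1 st2 x : frame (PFor i b p) st st1 -> frame p st1 st2 ->
    frame (PFor i b p) st (set_reg st2 i x).
  move: fok; rewrite /frame_ok /= inE negb_or => /andP[/andP[i4 p4] _].
  case=> [r1 m1 f1] [r2 m2 f2]; split=> [r|a a4|j v j4 js].
  - by rewrite /= inE negb_or => /andP[/negbTE ri rp]; rewrite ri r2 // r1 // inE negb_or ri.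
  - by rewrite /= m2 ?m1 // r1 //= inE negb_or i4.
  - by rewrite -[RHS]f1 // -f2 // /fld /= (negbTE i4).
have fok' : frame_ok p.
  by move: fok; rewrite /frame_ok /= inE negb_or => /andP[/andP[_ ->]].
have : regs st b <= regs st b by [].
elim: {1 3 4 5 6 7}(regs st b) => [|k IH] kN.
  split=> //=; first by rewrite eqxx.
  apply: (fstep st st); by split.
have [Ik ik fk] := IH (ltnW kN); split=> /=.
- exact: IS.
- by rewrite eqxx.
- by apply: fstep fk _; apply: sem_frame.
Qed.

Lemma frame_trans p q st st1 st2 : 4 \notin mods p ->
  {subset mods q <= mods p} -> {subset stores q <= stores p} ->
  frame p st st1 -> frame q st1 st2 -> frame p st st2.
Proof.
move=> p4 sm ss [r1 m1 f1] [r2 m2 f2]; split=> [r rp|a a4|j v j4 jp].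
- by rewrite r2 ?r1 //; apply: contra rp; apply: sm.
- by rewrite m2 ?m1 ?r1.
- by rewrite f2 ?f1 //; apply: contra jp; apply: ss.
Qed.

Global Opaque At addr.

(** * The search for alternating paths *)

(* Fields: 0 is the set of vertices put into the cover, 1 and 2 are the
   partners of the left and right copies of a vertex, 3 is the left copy from
   which a right copy was reached; entries of the last three are shifted by
   one, with 0 for none.

   Registers: 0 answer, 1 [n], 2 [m], 3 [l], 4 start of the array, 5 [n.+1],
   6 [2 ^ (4 * l + 2)], 7 [4 * l + 3], 8 bound on the size of the cover,
   9 current sequence of choices, 10 its remaining bits, 12 and 13 ends of an
   uncovered edge shifted by one, 16 and 17 ends of the edge read last, 18 free
   right copy reached shifted by one, 30 annihilation number; the others are
   temporary. *)

Definition load : prog :=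
  PAsg 16 (Defs.Mem (Add (Const 3) (Add (Reg 15) (Reg 15))));;
  PAsg 17 (Defs.Mem (Add (Const 4) (Add (Reg 15) (Reg 15)))).

Definition for_edges (body : prog) : prog := PFor 15 2 (load ;; body).

(** If [u] is unmatched, the truncated subtraction reads the entry of vertex 0; this is harmless, as
    the other summand already makes the test succeed. *)
Definition relax (u w : nat) : prog :=
  PIf (Add (Add (At 0 (Reg u)) (At 0 (Reg w))) (At 3 (Reg w))) PSkip
  (PIf (Add (Defs.Sub (Const 1) (At 1 (Reg u)))
            (At 3 (Defs.Sub (At 1 (Reg u)) (Const 1))))
    (PSto 3 (Reg w) (Add (Reg u) (Const 1)) ;;
     PIf (At 2 (Reg w)) PSkip (PAsg 18 (Add (Reg w) (Const 1))))
    PSkip).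

Definition search : prog :=
  PFor 14 1 (PSto 3 (Reg 14) (Const 0)) ;;
  PAsg 18 (Const 0) ;;
  PFor 14 1 (for_edges (relax 16 17 ;; relax 17 16)).

Section Encoding.
Variables (n l : nat) (e : rel 'I_n) (s : seq ('I_n * 'I_n)).
Hypothesis sym_e : symmetric e.
Hypothesis edges_s : forall u w, e u w = ((u, w) \in s) || ((w, u) \in s).
Implicit Types (D Z : {set 'I_n}) (M : {set 'I_n * 'I_n}).

Definition ready st :=
  [/\ regs st 1 = n, regs st 2 = size s, regs st 4 = 3 + (size s + size s) &
      forall a, a < 3 + (size s + size s) -> memory st a = memory (input_state l s) a].

Lemma ready_frame p st st' : frame p st st' ->
  all (fun r => r \notin mods p) [:: 1; 2; 4] -> ready st -> ready st'.
Proof.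
move=> [r1 m1 _] /= /and4P[p1 p2 p4 _] [s1 s2 s4 sm].
by split=> [|||a ha]; rewrite ?r1 // m1 ?sm // s4.
Qed.

Lemma input_edge p0 j : j < size s ->
  memory (input_state l s) (3 + (j + j)) = (nth p0 s j).1 /\
  memory (input_state l s) (4 + (j + j)) = (nth p0 s j).2.
Proof.
rewrite -[3 + _]/((j + j).+3) -[4 + _]/((j + j).+4) /=.
elim: s j => //= p r IH [|j] //=; rewrite ltnS => /IH [h1 h2].
by rewrite !addnS /=.
Qed.

Lemma sem_edges (I : seq ('I_n * 'I_n) -> state -> Prop) body st :
  frame_ok (for_edges body) ->
  all (fun r => r \notin mods body) [:: 1; 2; 4] ->
  ready st ->
  (forall t st r v, r \in [:: 15; 16; 17] -> I t st -> I t (set_reg st r v)) ->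
  I [::] st ->
  (forall t p st', p \in s -> regs st' 16 = p.1 -> regs st' 17 = p.2 ->
     frame (for_edges body) st st' -> I t st' -> I (rcons t p) (sem body st')) ->
  I s (sem (for_edges body) st).
Proof.
move=> fok mb rst Ireg I0 IS; have [r1 r2 r4 rm] := rst.
suff : I (take (regs st 2) s) (sem (for_edges body) st) by rewrite r2 take_size.
apply: (sem_for (I := fun k st' => I (take k s) st')) => //.
  by rewrite take0; apply: (Ireg).
move=> k st'; rewrite r2 => ks k15 fr Ik; apply: (Ireg) => //.
have p0 : 'I_n * 'I_n by move: ks; clear; case: s.
rewrite (take_nth p0) //.
have rdy : ready st'.
  apply: ready_frame fr _ rst; move: mb => /= /and4P[? ? ? _].
  by rewrite /= !inE /=; apply/and4P.
have [_ _ r4' rm'] := rdy; have [m1 m2] := input_edge p0 ks.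
have lo : k + k < size s + size s by lia.
apply: (IS _ _ (sem load st')); rewrite ?mem_nth //.
- by rewrite /= k15 rm' // ltn_add2l.
- by rewrite /= k15 rm' //; lia.
- apply: frame_trans fr (sem_frame st' (p := load) isT).
  + by move: fok => /andP[].
  + by move=> r; rewrite /= !inE => /orP[]->; rewrite ?orbT.
  + by [].
- by rewrite /=; apply: (Ireg) => //; apply: (Ireg).
Qed.

(** The bound [f u <= n] excludes values that stand for no vertex, so a nonzero entry always yields
    a partner. *)
Definition code (f : nat -> nat) (R : rel 'I_n) :=
  (forall u w : 'I_n, (f u == w.+1) = R u w) /\ (forall u : 'I_n, f u <= n).

Lemma code_case f R (u : 'I_n) : code f R ->
  (f u = 0 /\ forall w, ~~ R u w) \/ (exists2 w : 'I_n, f u = w.+1 & R u w).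
Proof.
case=> h b; case E: (f u) => [|k].
  by left; split=> // w; rewrite -h E.
by have := b u; rewrite E => kn; right; exists (Ordinal kn); rewrite -?h ?E.
Qed.

Definition coded st D M :=
  [/\ forall v : 'I_n, fld st 0 v = (v \in D),
      code (fld st 1) (fun u w => (u, w) \in M) &
      code (fld st 2) (fun w u => (u, w) \in M)].

Lemma eq_coded st st' D M :
  (forall j v, j < 3 -> fld st' j v = fld st j v) -> coded st D M -> coded st' D M.
Proof.
move=> h [h0 [h1 b1] [h2 b2]]; split=> [v||]; first by rewrite h.
- by split=> *; rewrite h.
- by split=> *; rewrite h.
Qed.

Lemma coded_frame p st st' D M : frame p st st' ->
  all (fun j => j \notin stores p) [:: 0; 1; 2] -> coded st D M -> coded st' D M.
Proof.
move=> [_ _ f] /= /and4P[p0 p1 p2 _]; apply: eq_coded => j v j3.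
by apply: f; [exact: ltn_trans j3 _|case: j j3 => [|[|[|]]]].
Qed.

Definition par st : rel 'I_n := fun w u => fld st 3 w == u.+1.
Definition reached st : {set 'I_n} := [set w : 'I_n | fld st 3 w != 0].

Lemma par_fun st w u u' : par st w u -> par st w u' -> u = u'.
Proof. by rewrite /par => /eqP-> /eqP[] /val_inj. Qed.

Section Search.
Variables (D : {set 'I_n}) (M : {set 'I_n * 'I_n}).
Hypothesis dM : dmatching e D M.

Definition closed_at Z (u w : 'I_n) :=
  u \notin D -> w \notin D -> (forall w', (u, w') \in M -> w' \in Z) -> w \in Z.

(** Path lengths are kept below the number of reached vertices, hence below [n], the number of
    iterations of [augment]. *)
Definition search_inv st :=
  [/\ forall w, w \in reached st ->
        exists2 j, j < #|reached st| & alternating e D M (par st) j w,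
      regs st 18 = 0 -> forall w, w \in reached st -> exists u, (u, w) \in M &
      regs st 18 <> 0 -> exists w : 'I_n,
        [/\ regs st 18 = w.+1, w \in reached st & forall u, (u, w) \notin M]].

Lemma relax_inv st ru rw (u w : 'I_n) : coded st D M -> e u w ->
  regs st ru = u -> regs st rw = w -> ru != 18 -> rw != 18 -> search_inv st ->
  search_inv (sem (relax ru rw) st) /\
  ((reached (sem (relax ru rw) st) = reached st /\ closed_at (reached st) u w) \/
   (#|reached st| < #|reached (sem (relax ru rw) st)| /\ ~ closed_at (reached st) u w)).
Proof.
move=> [c0 c1 c2] euw eu ew ru18 rw18 inv; rewrite /relax /=.
rewrite !eval_At /= ?eval_At /= eu ew !c0.
case: ifPn => [g|/negPn]; rewrite /= ?eval_At.
  split=> //; left; split=> // uD wD _; rewrite inE.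
  by move: g; rewrite (negbTE uD) (negbTE wD).
rewrite !addn_eq0 -!andbA !eqb0 => /and3P[uD wD /eqP w0].
have w_nr : w \notin reached st by rewrite inE w0.
case: ifPn => [g|/negPn g]; rewrite ?eval_addr /= ?eval_At /= ?eu ?ew ?addn1; last first.
  split=> //; left; split=> // _ _ h; move: g; case: (code_case u c1) => [[-> _]|[w' -> uw']] //.
  by move: (h _ uw'); rewrite inE subn1 /= => /negbTE->.
set st1 := set_mem st _ _; set st2 := (if _ then _ else _).
have fE j v : j < 4 -> fld st2 j v = if (j == 3) && (v == w :> nat) then u.+1 else fld st j v.
  by move=> j4; rewrite -fld_store // /st2; case: ifP => _ //; rewrite fld_set_reg.
have rE : (fld st 2 w != 0 /\ regs st2 18 = regs st 18) \/
          (fld st 2 w = 0 /\ regs st2 18 = w.+1).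
  rewrite /st2 fld_store //=; case: ifPn => [|/negPn/eqP]; first by left.
  by right.
move: {st1} st2 fE rE => st2 fE rE.
have reE : reached st2 = w |: reached st.
  apply/setP => v; rewrite !inE fE //= (inj_eq val_inj).
  by case: (v == w).
have rcard : #|reached st2| = #|reached st|.+1 by rewrite reE cardsU1 w_nr.
have parE : par st2 w u by rewrite /par fE //= eqxx.
have parS v x : par st v x -> par st2 v x.
  rewrite /par fE //=; case: (eqVneq (v : nat) w) => [/val_inj ->|//].
  by rewrite w0.
have [i1 i2 i3] := inv.
have notcl : ~ closed_at (reached st) u w.
  move/(_ uD wD) => h; case/negP: w_nr; apply: h => w' uw'.
  move: g; case: (code_case u c1) => [[_ nu]|[w1 -> uw1]]; first by rewrite (negbTE (nu _)) in uw'.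
  have [_ f _] := dM; by rewrite (f _ _ _ uw' uw1) subn1 /= inE.
split; last by right; rewrite rcard.
split.
- move=> v; rewrite rcard reE => /setU1P[->|]; last first.
    by case/i1=> j jK al; exists j; [exact: leqW|exact: alternating_mono al].
  case: (code_case u c1) => [[_ nu]|[w1 E1 uw1]].
    by exists 0 => //; apply: AltStart parE euw uD wD nu.
  have : w1 \in reached st.
    by move: g; rewrite E1 subn1 /= inE.
  case/i1=> j jK al; exists j.+1 => //; apply: AltStep parE euw wD uw1 _.
  exact: alternating_mono al.
- case: rE => [[w2 ->]|[_ ->]] // r0 v; rewrite reE => /setU1P[->|]; last exact: i2.
  by case: (code_case w c2) => [[E _]|[u1 _ ?]]; [rewrite E in w2|exists u1].
- case: rE => [[w2 ->]|[w2 ->]] => [/i3|_].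
    by case=> v [? vr ?]; exists v; split; rewrite // reE setU1r.
  exists w; split; rewrite ?reE ?setU11 // => u1; case: (code_case w c2) => [[_ h]|[u2 E _]].
    exact: h.
  by rewrite E in w2.
Qed.

Definition closed st := forall u w, e u w -> closed_at (reached st) u w.

(** Describes a pass in progress over the edges, with [R] the pairs examined. A gain of a vertex
    settles the second alternative for good; without a gain the reached set is unchanged, so the
    pairs examined remain closed and the pass ends with a closed set. Hence [n] passes suffice. *)
Definition progress k (R : 'I_n -> 'I_n -> Prop) st :=
  [\/ closed st, k < #|reached st| |
      k <= #|reached st| /\ forall u w, R u w -> closed_at (reached st) u w].

Lemma relax_progress k R st ru rw (u w : 'I_n) : coded st D M -> e u w ->
  regs st ru = u -> regs st rw = w -> ru != 18 -> rw != 18 -> search_inv st ->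
  progress k R st ->
  progress k (fun a b => R a b \/ (a = u /\ b = w)) (sem (relax ru rw) st).
Proof.
move=> cst euw eu ew ru18 rw18 inv.
have [_] := relax_inv cst euw eu ew ru18 rw18 inv.
rewrite /progress /closed; case=> [[-> cuw]|[lt ncuw]].
  case=> [h|h|[h1 h2]]; [by constructor 1|by constructor 2|constructor 3].
  by split=> // a b [/h2//|[-> ->]].
case=> [/(_ _ _ euw)//|h|[h _]]; constructor 2; last exact: leq_ltn_trans lt.
exact: ltn_trans lt.
Qed.

Lemma pass_inv k st : ready st -> coded st D M -> search_inv st ->
  closed st \/ k <= #|reached st| ->
  let st' := sem (for_edges (relax 16 17 ;; relax 17 16)) st in
  search_inv st' /\ (closed st' \/ k < #|reached st'|).
Proof.
move=> rst cst inv hk st'.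
pose R (t : seq ('I_n * 'I_n)) (u w : 'I_n) := (u, w) \in t \/ (w, u) \in t.
have [] : search_inv st' /\ progress k (R s) st'.
  apply: (sem_edges (I := fun t st => search_inv st /\ progress k (R t) st)) => //.
  - by move=> t st1 r v; rewrite !inE => /or3P[]/eqP->.
  - split=> //; case: hk => hk; first by constructor 1.
    by constructor 3; split=> // u w [].
  move=> t p st1 ps e1 e2 fr [inv1 pr1].
  have euw : e p.1 p.2 by rewrite edges_s -surjective_pairing ps.
  have ewu : e p.2 p.1 by rewrite sym_e.
  have cst1 : coded st1 D M.
    exact: coded_frame fr isT cst.
  have pr2 := relax_progress cst1 euw e1 e2 isT isT inv1 pr1.
  have [inv2 _] := relax_inv cst1 euw e1 e2 isT isT inv1.
  have fr2 := sem_frame st1 (p := relax 16 17) isT.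
  have cst2 := coded_frame fr2 isT cst1; have {}fr2 := let: And3 h _ _ := fr2 in h.
  have e1' : regs (sem (relax 16 17) st1) 16 = p.1 by rewrite fr2.
  have e2' : regs (sem (relax 16 17) st1) 17 = p.2 by rewrite fr2.
  have pr3 := relax_progress cst2 ewu e2' e1' isT isT inv2 pr2.
  have [inv3 _] := relax_inv cst2 ewu e2' e1' isT isT inv2.
  split=> //; case: pr3 => [h|h|[h1 h2]]; [by constructor 1|by constructor 2|constructor 3].
  split=> // u w ruw; apply: h2; move: ruw; rewrite /R !mem_rcons !inE [p]surjective_pairing.
  case=> /orP[/eqP[-> ->]|h]; by auto.
move=> inv' [h|h|[h1 h2]]; split=> //; auto.
by left=> u w; rewrite edges_s => /orP h; apply: h2.
Qed.

Lemma search_spec st : ready st -> coded st D M ->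
  let st' := sem search st in
  (regs st' 18 = 0 /\ lp e D = 2 * #|D| + #|M|) \/
  (exists w : 'I_n, [/\ regs st' 18 = w.+1, forall u, (u, w) \notin M &
     exists2 j, j < n & alternating e D M (par st') j w]).
Proof.
move=> rst cst.
set clear := PFor 14 1 (PSto 3 (Reg 14) (Const 0)).
pose st1 := sem clear st.
have fr1 : frame clear st st1 by apply: sem_frame.
have z1 v : v < regs st 1 -> fld st1 3 v = 0.
  move: v; apply: (sem_for (I := fun k st' => forall v, v < k -> fld st' 3 v = 0)) => //.
  move=> k st' _ k14 _ IH v; rewrite ltnS leq_eqVlt.
  rewrite fld_set_reg //= eval_addr fld_store //= k14.
  by case: eqP => //= _ /IH.
pose st2 := sem (PAsg 18 (Const 0)) st1.
have fr2 : frame (PAsg 18 (Const 0)) st1 st2 by apply: sem_frame.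
have rst2 : ready st2 := ready_frame fr2 isT (ready_frame fr1 isT rst).
have cst2 := coded_frame fr2 isT (coded_frame fr1 isT cst).
have re2 : reached st2 = set0.
  by apply/setP => v; rewrite !inE /st2 /= fld_set_reg // z1 //; case: rst => ->.
have [n2 _ _ _] := rst2.
pose pass := for_edges (relax 16 17 ;; relax 17 16).
pose st' := sem (PFor 14 1 pass) st2.
have [inv' cl'] : search_inv st' /\ (closed st' \/ regs st2 1 <= #|reached st'|).
  apply: (sem_for (I := fun k st' => search_inv st' /\ (closed st' \/ k <= #|reached st'|))) => //.
    split; last by right.
    split=> [w||//]; first by rewrite -[reached _]/(reached st2) re2 inE.
    by move=> _ w; rewrite -[reached _]/(reached st2) re2 inE.
  move=> k st3 _ _ fr3 [inv3 cl3].
  by apply: pass_inv inv3 cl3; [exact: ready_frame fr3 isT rst2|exact: coded_frame fr3 isT cst2].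
have {}cl' : closed st'.
  case: cl' => //; rewrite n2 => full u w euw _ _ _.
  have /eqP -> : reached st' == setT by rewrite eqEcard subsetT cardsT card_ord.
  by rewrite inE.
have [i1 i2 i3] := inv'.
rewrite -[sem search st]/st'; case: (eqVneq (regs st' 18) 0) => [r0|/eqP/i3[w [rw wr nw]]].
  left; split=> //; apply: (closed_lp sym_e dM (Z := reached st')).
  - by move=> w /i1[j _ []].
  - exact: i2.
  - by move=> u w euw uD wD h; apply: (cl' u w euw uD wD).
right; exists w; split=> //; have [j jK al] := i1 _ wr; exists j => //.
by apply: leq_trans jK _; rewrite -[X in _ <= X]card_ord max_card.
Qed.

End Search.
End Encoding.

(** * One round *)

Definition augment_step : prog :=
  PAsg 17 (Defs.Sub (Reg 18) (Const 1)) ;;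
  PAsg 16 (Defs.Sub (At 3 (Reg 17)) (Const 1)) ;;
  PAsg 18 (At 1 (Reg 16)) ;;
  PSto 1 (Reg 16) (Add (Reg 17) (Const 1)) ;;
  PSto 2 (Reg 17) (Add (Reg 16) (Const 1)) ;;
  PIf (Reg 18) (PSto 2 (Defs.Sub (Reg 18) (Const 1)) (Const 0)) PSkip.

Definition augment : prog := PFor 14 1 (PIf (Reg 18) augment_step PSkip).

(** A matching has at most [n] pairs, so one of [n.+1] searches fails; from then on [augment] is
    idle. *)
Definition maximize : prog := PFor 20 5 (search ;; augment).

Definition remove (r : nat) : prog :=
  PAsg 19 (At 1 (Reg r)) ;;
  PAsg 24 (At 2 (Reg r)) ;;
  PSto 0 (Reg r) (Const 1) ;;
  PSto 1 (Reg r) (Const 0) ;;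
  PSto 2 (Reg r) (Const 0) ;;
  PIf (Reg 19) (PSto 2 (Defs.Sub (Reg 19) (Const 1)) (Const 0)) PSkip ;;
  PIf (Reg 24) (PSto 1 (Defs.Sub (Reg 24) (Const 1)) (Const 0)) PSkip.

(** Run only when both copies of the vertex were matched, so registers 22 and 23 are nonzero. The
    search in between writes only field 3, and undoing the removal recovers the matching. *)
Definition restore : prog :=
  PSto 0 (Reg 21) (Const 0) ;;
  PSto 1 (Reg 21) (Reg 22) ;;
  PSto 2 (Defs.Sub (Reg 22) (Const 1)) (Add (Reg 21) (Const 1)) ;;
  PSto 2 (Reg 21) (Reg 23) ;;
  PSto 1 (Defs.Sub (Reg 23) (Const 1)) (Add (Reg 21) (Const 1)).

(** A vertex with an unmatched copy is skipped, which is correct by [settle_unmatched]; the vertices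
    already in the cover are among these. *)
Definition reduce_prog : prog :=
  PFor 21 1
    (PAsg 22 (At 1 (Reg 21)) ;;
     PAsg 23 (At 2 (Reg 21)) ;;
     PIf (Reg 22)
       (PIf (Reg 23) (remove 21 ;; search ;; PIf (Reg 18) restore PSkip) PSkip)
       PSkip).

Definition scan : prog :=
  PAsg 12 (Const 0) ;;
  PAsg 13 (Const 0) ;;
  for_edges (PIf (Add (At 0 (Reg 16)) (At 0 (Reg 17))) PSkip
    (PAsg 12 (Add (Reg 16) (Const 1)) ;; PAsg 13 (Add (Reg 17) (Const 1)))).

(** * Correctness of the phases of a round *)

Section Phases.
Variables (n l : nat) (e : rel 'I_n) (s : seq ('I_n * 'I_n)).
Hypotheses (sym_e : symmetric e) (irr_e : irreflexive e).
Hypothesis edges_s : forall u w, e u w = ((u, w) \in s) || ((w, u) \in s).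
Implicit Types (D Z : {set 'I_n}) (M : {set 'I_n * 'I_n}).

Let ready := ready l s.

(** [M'] is described by membership so that both outcomes of [alternating_augment], the addition of
    a pair and the exchange of one, are instances. *)
Lemma augment_step_spec st D M (u w : 'I_n) : coded st D M -> dmatching e D M ->
  (forall u, (u, w) \notin M) -> regs st 18 = w.+1 -> par st w u ->
  let st' := sem augment_step st in
  regs st' 18 = fld st 1 u /\
  forall M', (forall x y, (x, y) \in M' = if x == u then y == w else (x, y) \in M) ->
  coded st' D M'.
Proof.
move=> [c0 c1 c2] dM nw e18 /eqP pwu st'.
have [h f g] := dM.
pose x := fld st 1 u.
have [e18' F] : regs st' 18 = x /\ forall j v, j < 4 -> fld st' j v =
    if [&& j == 2, x != 0 & v == x.-1] then 0 else
    if (j == 2) && (v == w) then u.+1 else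
    if (j == 1) && (v == u) then w.+1 else fld st j v.
  rewrite /st' /augment_step /= !eval_addr /= !eval_At /= e18 !subn1 /= !fld_set_reg //= pwu /= !addn1 -/x.
  split; first by case: ifP.
  by move=> j v j4; case: eqP => _ /=; rewrite !(fld_store, fld_set_reg) //= ?andbF.
split=> // M' hM'; split=> [v||].
- by rewrite F //= c0.
- split=> [v y|v]; rewrite F //= ?hM' (inj_eq val_inj).
    by have [_|_] := eqVneq v u; [rewrite eqSS eq_sym|case: c1].
  by case: (v == u); [exact: ltn_ord|case: c1].
- split=> [v y|v]; rewrite F //=; last first.
    by case: ifP => // _; case: ifP => [_|_]; [exact: ltn_ord|case: c2].
  rewrite (inj_eq val_inj) hM'.
  have [vw|nvw] := eqVneq v w.
    rewrite vw; case: ifP => [/andP[x0 /eqP xw]|_].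
      have [[E _]|[w' E uw']] := code_case u c1; first by rewrite /x E in x0.
      move: xw; rewrite /x E /= => /val_inj Ew.
      by move: (nw u); rewrite Ew uw'.
    rewrite eqSS (negbTE (nw _)) -[_ == _ :> nat]/(u == y) [u == y]eq_sym.
    by case: (y == u).
  have [[E nu]|[w' E uw']] := code_case u c1; rewrite /x E /=.
    case: c2 => -> _; case: (eqVneq y u) => // ->; exact/negbTE/nu.
  have [->|nvw'] := eqVneq v w'.
    rewrite eqxx /=; case: (eqVneq y u) => // yu; apply/esym/negbTE/negP => yw'.
    by rewrite (g _ _ _ yw' uw') eqxx in yu.
  rewrite (inj_eq val_inj) (negbTE nvw'); case: c2 => -> _; case: (eqVneq y u) => // ->.
  by apply/negbTE/negP => uv; rewrite (f _ _ _ uv uw') eqxx in nvw'.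
Qed.

Lemma augment_spec st D M (w : 'I_n) j : ready st -> coded st D M -> dmatching e D M ->
  (forall u, (u, w) \notin M) -> regs st 18 = w.+1 ->
  j < n -> alternating e D M (par st) j w ->
  let st' := sem augment st in
  regs st' 18 = 0 /\
  exists M', [/\ coded st' D M', dmatching e D M' & #|M'| = #|M|.+1].
Proof.
move=> rst cst dM nw e18 jn al st'.
(* The remaining length [i] satisfies [i + k < n], so the second case is impossible after [n]
   iterations. Paths refer to the parents in the initial state [st], as field 3 is never written. *)
pose I k st1 := (regs st1 18 = 0 /\
    exists M', [/\ coded st1 D M', dmatching e D M' & #|M'| = #|M|.+1]) \/
  (exists M' (w' : 'I_n) i, [/\ coded st1 D M', dmatching e D M', #|M'| = #|M|,
     regs st1 18 = w'.+1 & [/\ forall u, (u, w') \notin M', i + k < n &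
     alternating e D M' (par st) i w']]).
have n1 : regs st 1 = n by case: rst.
have : I (regs st 1) st'.
  apply: (sem_for (I := I)) => //.
    by right; exists M, w, j; split; rewrite ?addn0.
  move=> k st1 kn k14 fr [[e0 [M' [cM' dM' cardM']]]|].
    by left; rewrite /= e0 /=; split=> //; exists M'.
  case=> M' [w' [i [cM' dM' cardM' e18' [nw' ik al']]]].
  have [u pu] := alternating_parent al'.
  have parE : par st1 =2 par st.
    by move=> a b; rewrite /par; case: fr => _ _ ->.
  have pu1 : par st1 w' u by rewrite parE.
  have [e18s h] := augment_step_spec cM' dM' nw' e18' pu1.
  rewrite sem_then; last by rewrite /= e18'.
  move: (sem augment_step st1) e18s h => st2 e18s h.
  have := alternating_augment (@par_fun n st) dM' nw' pu al'.
  have [_ f _] := dM'; have [_ c1 _] := cM'.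
  case: i al' ik => [|i] al' ik.
    case=> nu dM1 cM1; left; split.
      rewrite /= e18s; case: (code_case u c1) => [[-> _]//|[x _ ux]].
      by rewrite (negbTE (nu x)) in ux.
    exists ((u, w') |: M'); split; rewrite ?cM1 ?cardM' //.
    apply: h => x y; rewrite !inE xpair_eqE; have [->|//] := eqVneq x u.
    by rewrite (negbTE (nu y)) orbF.
  case=> w2 [uw2 _ dM1 cM1 [nw2 al2]]; right.
  exists ((u, w') |: M' :\ (u, w2)), w2, i; split; rewrite ?cM1 //.
  - apply: h => x y; rewrite !inE !xpair_eqE; have [->|//] := eqVneq x u.
    case: (boolP ((u, y) \in M')) => [uy|_]; rewrite ?andbF ?orbF //=.
    by rewrite (f _ _ _ uy uw2) eqxx orbF.
  - rewrite /= e18s; case: (code_case u c1) => [[_ nu]|[x -> ux]].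
      by rewrite (negbTE (nu w2)) in uw2.
    by rewrite (f _ _ _ ux uw2).
  - by split=> //; rewrite addnS.
rewrite n1; case=> [//|[M' [w' [i [_ _ _ _ [_ + _]]]]]].
by rewrite ltnNge leq_addl.
Qed.

Lemma augment_idle st D M : regs st 18 = 0 -> coded st D M ->
  coded (sem augment st) D M.
Proof.
move=> e0 cst.
have [] // : regs (sem augment st) 18 = 0 /\ coded (sem augment st) D M.
apply: (sem_for (I := fun _ st' => regs st' 18 = 0 /\ coded st' D M)) => //.
by move=> k st1 _ _ _ [e1 c1]; rewrite sem_else.
Qed.

Lemma maximize_spec st D M : ready st -> regs st 5 = n.+1 -> coded st D M ->
  dmatching e D M ->
  exists M', [/\ coded (sem maximize st) D M', dmatching e D M' &
                lp e D = 2 * #|D| + #|M'|].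
Proof.
move=> rst r5 cst dM.
pose I k st1 := exists M', [/\ coded st1 D M', dmatching e D M' &
  lp e D = 2 * #|D| + #|M'| \/ k <= #|M'|].
have : I (regs st 5) (sem maximize st).
  apply: (sem_for (I := I)) => //; first by exists M; split; rewrite ?leq0n; auto.
  move=> k st1 kn k20 fr [M' [cM' dM' hM']].
  have rst1 : ready st1 := ready_frame fr isT rst.
  have fr2 := sem_frame st1 (p := search) isT.
  have rst2 := ready_frame fr2 isT rst1.
  have cM2 := coded_frame fr2 isT cM'.
  have [[e18 E]|[w [e18 nw [j jn al]]]] := search_spec sym_e edges_s dM' rst1 cM'.
    by exists M'; split; auto; exact: augment_idle e18 cM2.
  have [_ [M2 [cM3 dM2 cardM2]]] := augment_spec rst2 cM2 dM' nw e18 jn al.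
  exists M2; split=> //; right; case: hM' => [E|]; last by rewrite cardM2.
  by have := dmatching_lp dM2; rewrite E leq_add2l cardM2 ltnn.
case=> M' [cM' dM' [E|]]; first by exists M'.
by have := dmatching_card dM'; rewrite r5 card_ord => h1 h2; have := leq_trans h2 h1; rewrite ltnn.
Qed.

Lemma fld_remove st r j v : j < 4 -> r \notin [:: 4; 19; 24] ->
  let x := fld st 1 (regs st r) in let y := fld st 2 (regs st r) in
  fld (sem (remove r) st) j v =
  if (j == 0) && (v == regs st r) then 1 else
  if (j == 1) && ((v == regs st r) || (y != 0) && (v == y.-1)) then 0 else
  if (j == 2) && ((v == regs st r) || (x != 0) && (v == x.-1)) then 0 else
  fld st j v.
Proof.
rewrite !inE !negb_or => j4 /and3P[r4 r19 r24] x y.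
rewrite /remove /= !eval_addr /= !eval_At /= !subn1 (negbTE r19) (negbTE r24) /=.
rewrite !fld_set_reg //= -/x -/y.
case: j j4 => [|[|[|[|]]]] // _.
- by case: (x != 0); case: (y != 0); rewrite /= !(fld_store, fld_set_reg).
- by case: (x != 0); case: (y != 0); rewrite /= !(fld_store, fld_set_reg) //=; do ?[case: eqP].
- by case: (x != 0); case: (y != 0); rewrite /= !(fld_store, fld_set_reg) //=; do ?[case: eqP].
- by case: (x != 0); case: (y != 0); rewrite /= !(fld_store, fld_set_reg).
Qed.

Lemma remove_spec st D M r (v : 'I_n) : r \notin [:: 4; 19; 24] ->
  coded st D M -> dmatching e D M -> regs st r = v ->
  coded (sem (remove r) st) (v |: D) (unmatch M v).
Proof.
move=> hr [c0 c1 c2] [_ f g] rv; split=> [a||].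
- by rewrite fld_remove //= rv c0 !inE (inj_eq val_inj); case: (a == v).
- split=> [a b|a]; rewrite fld_remove //= rv (inj_eq val_inj); last first.
    by case: ifP => // _; case: c1.
  rewrite !inE /=; have [av|av] := eqVneq a v; rewrite ?andbF ?andbT //=.
  have [[-> nv]|[u -> uv]] := code_case v c2; rewrite ?eqxx /=.
    case: c1 => -> _; have [->|_] := eqVneq b v; last by rewrite andbT.
    by rewrite andbF; apply/negbTE/nv.
  rewrite (inj_eq val_inj); have [->|au] := eqVneq a u.
    by case: (boolP ((u, b) \in M)) => //= ub; rewrite (f _ _ _ ub uv) eqxx.
  case: c1 => -> _; have [->|_] := eqVneq b v; last by rewrite andbT.
  by rewrite andbF; apply/negbTE/negP => av'; rewrite (g _ _ _ av' uv) eqxx in au.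
- split=> [b a|a]; rewrite fld_remove //= rv (inj_eq val_inj); last first.
    by case: ifP => // _; case: c2.
  rewrite !inE /=; have [bv|bv] := eqVneq b v; rewrite ?andbF ?andbT //=.
  have [[-> nv]|[u -> uv]] := code_case v c1; rewrite ?eqxx /=.
    case: c2 => -> _; have [->|_] := eqVneq a v; last by rewrite andbT.
    by rewrite andbF; apply/negbTE/nv.
  rewrite (inj_eq val_inj); have [->|au] := eqVneq b u.
    by case: (boolP ((a, u) \in M)) => //= ub; rewrite (g _ _ _ ub uv) eqxx.
  case: c2 => -> _; have [->|_] := eqVneq a v; last by rewrite andbT.
  by rewrite andbF; apply/negbTE/negP => av'; rewrite (f _ _ _ av' uv) eqxx in au.
Qed.

Lemma fld_restore st j x : j < 4 ->
  let v := regs st 21 in let a := regs st 22 in let b := regs st 23 in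
  fld (sem restore st) j x =
  if (j == 0) && (x == v) then 0 else
  if (j == 1) && (x == b.-1) then v.+1 else
  if (j == 1) && (x == v) then a else
  if (j == 2) && (x == v) then b else
  if (j == 2) && (x == a.-1) then v.+1 else fld st j x.
Proof.
move=> j4 v a b; rewrite /restore /= !eval_addr /= !subn1 !addn1 -/v -/a -/b.
by case: j j4 => [|[|[|[|]]]] // _; rewrite !fld_store.
Qed.

Lemma take_enum (v : 'I_n) : take v.+1 (enum 'I_n) = rcons (take v (enum 'I_n)) v.
Proof. by rewrite (take_nth v) ?size_enum_ord // nth_ord_enum. Qed.

Lemma reduce_spec st D M : ready st -> coded st D M -> dmatching e D M ->
  lp e D = 2 * #|D| + #|M| ->
  exists M', coded (sem reduce_prog st) (reduce e D) M' /\ dmatching e (reduce e D) M'.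
Proof.
move=> rst cst dM lpD.
pose Dk k := foldl (settle e) D (take k (enum 'I_n)).
pose I k st1 := exists M', [/\ coded st1 (Dk k) M', dmatching e (Dk k) M' &
  lp e (Dk k) = 2 * #|Dk k| + #|M'|].
have n1 : regs st 1 = n by case: rst.
have : I (regs st 1) (sem reduce_prog st).
  apply: (sem_for (I := I)) => //; first by rewrite /I /Dk take0; exists M.
  move=> k st1; rewrite n1 => kn k21 fr [M1 [cM1 dM1 lp1]].
  have rst1 : ready st1 := ready_frame fr isT rst.
  have [v vk] : exists v : 'I_n, v = k :> nat by exists (Ordinal kn).
  have DkS : Dk k.+1 = settle e (Dk k) v by rewrite /Dk -vk take_enum foldl_rcons.
  rewrite /I DkS; move: (Dk k) cM1 dM1 lp1 => D1 cM1 dM1 lp1 {DkS}.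
  set st2 := sem (PAsg 23 (At 2 (Reg 21))) (sem (PAsg 22 (At 1 (Reg 21))) st1).
  have fr2 := sem_frame st1 (p := PAsg 22 (At 1 (Reg 21)) ;; PAsg 23 (At 2 (Reg 21))) isT.
  have cM2 : coded st2 D1 M1 := coded_frame fr2 isT cM1.
  have rst2 : ready st2 := ready_frame fr2 isT rst1.
  have e21 : regs st2 21 = v by rewrite /= k21 vk.
  have e22 : regs st2 22 = fld st2 1 v.
    by rewrite /st2 /= !eval_At /= !fld_set_reg //= k21 vk.
  have e23 : regs st2 23 = fld st2 2 v.
    by rewrite /st2 /= !eval_At /= !fld_set_reg //= k21 vk.
  rewrite 2!sem_seq -/st2; move: st2 cM2 rst2 e21 e22 e23 {fr2} => st2 cM2 rst2 e21 e22 e23.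
  have [c0 c1 c2] := cM2.
  have [[z1 nv]|[w vw' vw]] := code_case v c1.
    rewrite sem_else; last by rewrite /= e22.
    rewrite (settle_unmatched dM1 lp1); last by left.
    by exists M1.
  rewrite sem_then; last by rewrite /= e22 vw'.
  have [[z2 nv]|[u uv' uv]] := code_case v c2.
    rewrite sem_else; last by rewrite /= e23.
    rewrite (settle_unmatched dM1 lp1); last by right.
    by exists M1.
  rewrite sem_then; last by rewrite /= e23 uv'.
  have fr3 := sem_frame st2 (p := remove 21) isT.
  have cM3 := @remove_spec st2 D1 M1 21 v isT cM2 dM1 e21.
  have f3 j x (j4 : j < 4) := @fld_remove st2 21 j x j4 isT.
  rewrite e21 in f3; rewrite (sem_seq (remove 21)) (sem_seq search).
  move: (sem (remove 21) st2) fr3 cM3 f3 => st3 fr3 cM3 f3.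
  have rst3 : ready st3 := ready_frame fr3 isT rst2.
  have dM3 := dmatching_unmatch dM1 v.
  have fr4 := sem_frame st3 (p := search) isT.
  have spec := search_spec sym_e edges_s dM3 rst3 cM3.
  move: (sem search st3) fr4 spec => st4 fr4 spec.
  case: spec => [[e18 tight]|[w' [e18 nw' [j jn al]]]].
    rewrite sem_else; last exact: e18.
    rewrite (settle_tight irr_e dM1 lp1 vw uv tight).
    exists (unmatch M1 v); split=> //; exact: coded_frame fr4 isT cM3.
  rewrite sem_then; last by rewrite /= e18.
  have [M5 [dM5 cM5]] := alternating_larger (@par_fun n st4) dM3 nw' al.
  rewrite (settle_larger irr_e dM1 lp1 vw uv dM5 cM5); exists M1; split=> //.
  have [[r3 _ _] [r4 _ f4]] := (fr3, fr4).
  have E21 : regs st4 21 = v by rewrite r4 // r3.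
  have E22 : regs st4 22 = w.+1 by rewrite r4 // r3 // e22.
  have E23 : regs st4 23 = u.+1 by rewrite r4 // r3 // e23.
  apply: eq_coded cM2 => i x i3; rewrite fld_set_reg //.
  have i4 : i < 4 := ltn_trans i3 (ltnSn 3).
  rewrite fld_restore // E21 E22 E23 f4 //; last by case: i i3 {i4} => [|[|[|]]].
  rewrite f3 //; move: i i3 {i4} => [|[|[|//]]] _ /=.
  - case: eqP => // ->; rewrite c0.
    by have [h _ _] := dM1; have [_ /negbTE-> _] := h _ _ vw.
  - case: eqP => [->|ux]; first by apply/esym/eqP; case: c1 => ->.
    by case: eqP => [->|vx] //=; rewrite uv' /=; case: eqP ux.
  - case: eqP => [->|ux]; first by [].
    case: eqP => [->|wx] //=; first by apply/esym/eqP; case: c2 => ->.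
    by rewrite vw' /=; case: eqP wx.
rewrite n1 => -[M' []]; rewrite /Dk take_oversize ?size_enum_ord // => cM' dM' _.
by exists M'.
Qed.

Lemma scan_spec st D M : ready st -> coded st D M ->
  let q := uncovered s D in
  regs (sem scan st) 12 = (if q is Some p then p.1.+1 else 0) /\
  regs (sem scan st) 13 = (if q is Some p then p.2.+1 else 0).
Proof.
move=> rst cst; rewrite /scan !sem_seq /uncovered.
set st1 := sem _ (sem _ st).
have fr1 : frame (PAsg 12 (Const 0) ;; PAsg 13 (Const 0)) st st1 by apply: sem_frame.
have rst1 : ready st1 := ready_frame fr1 isT rst.
have cst1 : coded st1 D M := coded_frame fr1 isT cst.
pose q (t : seq ('I_n * 'I_n)) :=
  foldl (fun r p => if (p.1 \in D) || (p.2 \in D) then r else Some p) None t.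
apply: (sem_edges (I := fun t st => regs st 12 = (if q t is Some p then p.1.+1 else 0) /\
  regs st 13 = (if q t is Some p then p.2.+1 else 0)) _ _ rst1) => //.
- by move=> t st2 r v; rewrite !inE => /or3P[]/eqP->.
move=> t p st2 ps e1 e2 fr [h1 h2].
have [c0 _ _] := coded_frame fr isT cst1.
rewrite /q foldl_rcons /= !eval_At /= e1 e2 !c0 !addn1.
by case: (p.1 \in D) => //=; case: (p.2 \in D).
Qed.

End Phases.

(** * Enumeration of the sequences of choices *)

Definition branch_prog : prog :=
  PAsg 10 (Add (Reg 10) (Reg 10)) ;;
  PIf (Defs.Sub (Add (Reg 10) (Const 1)) (Reg 6))
    (PAsg 10 (Defs.Sub (Reg 10) (Reg 6)) ;;
     PAsg 25 (Defs.Sub (Reg 13) (Const 1)) ;; remove 25)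
    (PAsg 25 (Defs.Sub (Reg 12) (Const 1)) ;; remove 25).

(** The vertex chosen in the previous round may have left a matching that is no longer maximum, so
    every round starts by maximizing it again. *)
Definition round : prog :=
  maximize ;; reduce_prog ;; scan ;; PIf (Reg 12) branch_prog PSkip.

Definition clear : prog :=
  PFor 14 1 (PSto 0 (Reg 14) (Const 0) ;; PSto 1 (Reg 14) (Const 0) ;;
             PSto 2 (Reg 14) (Const 0)).

Definition check : prog :=
  PAsg 25 (Const 0) ;;
  PFor 14 1 (PAsg 25 (Add (Reg 25) (At 0 (Reg 14)))) ;;
  PIf (Defs.Sub (Reg 25) (Reg 8)) PSkip (PAsg 0 (Const 1)).

Definition path_prog : prog :=
  clear ;; PAsg 10 (Reg 9) ;; PFor 11 7 round ;; scan ;;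
  PIf (Reg 12) PSkip check.

Definition solve : prog := PFor 9 6 path_prog.

Section Enumeration.
Variables (n l : nat) (e : rel 'I_n) (s : seq ('I_n * 'I_n)).
Hypotheses (sym_e : symmetric e) (irr_e : irreflexive e).
Hypothesis edges_s : forall u w, e u w = ((u, w) \in s) || ((w, u) \in s).
Implicit Types (D Z : {set 'I_n}) (M : {set 'I_n * 'I_n}).

Let ready := ready l s.

Lemma round_spec st D M : ready st -> regs st 5 = n.+1 -> coded st D M ->
  dmatching e D M ->
  let Dc := branch e s (regs st 6) (D, regs st 10) in
  regs (sem round st) 10 = Dc.2 /\
  exists M', coded (sem round st) Dc.1 M' /\ dmatching e Dc.1 M'.
Proof.
move=> rst r5 cst dM; rewrite /round (sem_seq maximize) (sem_seq reduce_prog) (sem_seq scan).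
have [M1 [cM1 dM1 lp1]] := maximize_spec sym_e edges_s rst r5 cst dM.
have fr1 := sem_frame st (p := maximize) isT.
have rst1 : ready (sem maximize st) := ready_frame fr1 isT rst.
have [M2 [cM2 dM2]] := reduce_spec sym_e irr_e edges_s rst1 cM1 dM1 lp1.
have fr2 := sem_frame (sem maximize st) (p := reduce_prog) isT.
have rst2 := ready_frame fr2 isT rst1.
have [e12 e13] := scan_spec rst2 cM2.
have fr3 := sem_frame (sem reduce_prog (sem maximize st)) (p := scan) isT.
have cM3 := coded_frame fr3 isT cM2.
rewrite /branch [(D, _).1]/= [(D, _).2]/=.
have [[[r1 _ _] [r2 _ _]] [r3 _ _]] := (fr1, fr2, fr3).
have e6 : regs (sem scan (sem reduce_prog (sem maximize st))) 6 = regs st 6.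
  by rewrite r3 // r2 // r1.
have e10 : regs (sem scan (sem reduce_prog (sem maximize st))) 10 = regs st 10.
  by rewrite r3 // r2 // r1.
move: (sem scan _) e6 e10 e12 e13 cM3 => st3 e6 e10.
case: (uncovered s _) => [p|] e12 e13 cM3; last first.
  by rewrite sem_else //; split=> //; exists M2.
rewrite sem_then; last by rewrite /= e12.
have rm st4 (v : 'I_n) : coded st4 (reduce e D) M2 -> regs st4 25 = v ->
    regs (sem (remove 25) st4) 10 = regs st4 10 /\
    exists M', coded (sem (remove 25) st4) (v |: reduce e D) M' /\
               dmatching e (v |: reduce e D) M'.
  move=> c4 e25; split; first exact: sem_regs.
  exists (unmatch M2 v); split; last exact: dmatching_unmatch.
  exact: (@remove_spec n e st4 _ _ 25 v isT c4 dM2 e25).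
(* With [c] the doubled content of register 10, the truncated [c + 1 - W] is nonzero exactly if
   [W <= c]. *)
rewrite /branch_prog sem_seq; case: ifPn => [leW|].
  rewrite sem_then; last by rewrite /= e10 e6; move: leW; clear; lia.
  rewrite 2!sem_seq; set st4 := sem (PAsg 25 _) _.
  have [|e10' h] := @rm st4 p.2 cM3; first by rewrite /= e13 subn1.
  by rewrite e10' /= e10 e6.
rewrite -ltnNge => ltW; rewrite sem_else; last by rewrite /= e10 e6; move: ltW; clear; lia.
rewrite sem_seq; set st4 := sem (PAsg 25 _) _.
have [|e10' h] := @rm st4 p.1 cM3; first by rewrite /= e12 subn1.
by rewrite e10' /= e10.
Qed.

Lemma clear_spec st : ready st -> coded (n := n) (sem clear st) set0 set0.
Proof.
move=> rst; have [n1 _ _ _] := rst.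
have z j v : v < n -> j < 3 -> fld (sem clear st) j v = 0.
  rewrite -[in v < _]n1.
  move: v; apply: (sem_for (I := fun k st' => forall v, v < k -> j < 3 -> fld st' j v = 0)) => //.
  move=> k st' _ k14 _ IH v; rewrite ltnS leq_eqVlt => vk j3.
  have j4 : j < 4 := ltn_trans j3 (ltnSn 3).
  rewrite fld_set_reg //= !eval_addr /= k14 !fld_store //.
  case: (eqVneq v k) vk => [_ _|_ /= vk]; last by rewrite !andbF IH.
  by case: j j3 {IH j4} => [|[|[|]]].
split=> [v||]; first by rewrite z // inE.
- by split=> [u w|u]; rewrite z // inE.
- by split=> [u w|u]; rewrite z // inE.
Qed.

Lemma check_spec st D M : ready st -> coded st D M ->
  regs (sem check st) 0 = if #|D| <= regs st 8 then 1 else regs st 0.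
Proof.
move=> rst [c0 _ _]; rewrite /check 2!sem_seq.
set st1 := sem (PAsg 25 _) st; set p := PFor _ _ _; set st2 := sem p st1.
have [n1 _ _ _] := rst.
have fr : frame p st1 st2 by apply: sem_frame.
have e25 : regs st2 25 = #|D|.
  have : regs st2 25 = #|D :&: [set v : 'I_n | v < regs st1 1]|.
    apply: (sem_for (I := fun k st' => regs st' 25 = #|D :&: [set v : 'I_n | v < k]|)) => //.
      by rewrite (_ : [set _ | _] = set0) ?setI0 ?cards0 //; apply/setP => v; rewrite !inE.
    move=> k st3; rewrite {1}[regs st1 1]n1 => kn k14 [_ _ f3] e25.
    have [v vk] : exists v : 'I_n, v = k :> nat by exists (Ordinal kn).
    rewrite /= eval_At /= k14 e25 f3 // -[fld st1 0 k]/(fld st 0 k) -vk c0.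
    rewrite (cardsD1 v (D :&: [set _ | _ < v.+1])) !inE ltnSn andbT addnC; congr (_ + #|_ : {set _}|).
    apply/setP => x; rewrite !inE ltnS [x <= v]leq_eqVlt (inj_eq val_inj).
    by case: eqVneq => [->|_] /=; rewrite ?ltnn ?andbF.
  move=> ->; congr (#|_ : {set _}|); apply/setP => v.
  by rewrite !inE [regs st1 1]n1 ltn_ord andbT.
have e8 : regs st2 8 = regs st 8 by case: fr => ->.
have e0 : regs st2 0 = regs st 0 by case: fr => ->.
by rewrite -subn_eq0 /= e25 e8; case: (_ - _ == 0).
Qed.

Definition final W b c := (iter b (branch e s W) (set0, c)).1.

Definition lucky W b k c := vertex_cover e (final W b c) && (#|final W b c| <= k).

Lemma path_spec st : ready st -> regs st 5 = n.+1 ->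
  regs (sem path_prog st) 0 =
  if lucky (regs st 6) (regs st 7) (regs st 8) (regs st 9) then 1 else regs st 0.
Proof.
move=> rst r5; rewrite /path_prog (sem_seq clear) 2!sem_seq (sem_seq scan).
set st1 := sem (PAsg 10 (Reg 9)) _; set p := PFor _ _ _; set st2 := sem p st1.
have fr1 : frame (clear ;; PAsg 10 (Reg 9)) st st1 by apply: sem_frame.
have cst1 : coded (n := n) st1 set0 set0.
  exact: coded_frame (sem_frame (sem clear st) (p := PAsg 10 (Reg 9)) isT) isT (clear_spec rst).
have rst1 := ready_frame fr1 isT rst.
have [r1 _ _] := fr1.
have e10 : regs st1 10 = regs st 9 by rewrite -(sem_regs st (r := 9) (p := clear)).
have dM0 : dmatching e set0 set0 by split=> [u w|u w w'|u u' w]; rewrite inE.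
have fr2 : frame p st1 st2 by apply: sem_frame.
pose I b st' := exists M, let Dc := iter b (branch e s (regs st 6)) (set0, regs st 9) in
  [/\ coded st' Dc.1 M, dmatching e Dc.1 M & regs st' 10 = Dc.2].
have : I (regs st1 7) st2.
  apply: (sem_for (I := I)) => //; first by exists set0.
  move=> k st3 _ _ fr3 [M3 [c3 d3 e3]].
  have [f3 _ _] := fr3.
  have [] := round_spec (ready_frame fr3 isT rst1) _ c3 d3; first by rewrite f3 // r1.
  rewrite f3 // r1 // e3 -surjective_pairing => e10' [M' [c' d']].
  by exists M'; split.
rewrite r1 //; case=> M [cM dM _].
have [e12 _] := scan_spec (ready_frame fr2 isT rst1) cM.
have fr3 := sem_frame st2 (p := scan) isT.
have [[r2 _ _] [r3 _ _]] := (fr2, fr3).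
have rst3 := ready_frame fr3 isT (ready_frame fr2 isT rst1).
have cM3 := coded_frame fr3 isT cM.
rewrite /lucky -/(final _ _ _).
rewrite -/(final _ _ _) in e12 cM.
case: (uncovered s _) (uncoveredP edges_s (final (regs st 6) (regs st 7) (regs st 9))) e12.
  move=> q [eq h1 h2] e12; rewrite sem_then; last by rewrite /= e12.
  rewrite [sem PSkip _]/= r3 // r2 // r1 //; case: ifP => // /andP[/vertex_coverP/(_ _ _ eq)].
  by rewrite (negbTE h1) (negbTE h2).
move=> -> e12; rewrite sem_else; last exact: e12.
by rewrite (check_spec rst3 cM3) !r3 // !r2 // !r1.
Qed.

(** A set found is checked to be a small cover, so a positive answer is always sound; the gap only
    serves to show that some sequence of choices succeeds. *)
Lemma solve_spec st b k : ready st -> regs st 5 = n.+1 -> regs st 0 = 0 ->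
  regs st 6 = 2 ^ b -> regs st 7 = b.+1 -> regs st 8 = k ->
  (cover_within e set0 k -> 2 * k <= lp e set0 + b) ->
  regs (sem solve st) 0 = cover_within e set0 k.
Proof.
move=> rst r5 r0 r6 r7 r8 gap.
have -> : regs (sem solve st) 0 = has (lucky (2 ^ b) b.+1 k) (iota 0 (regs st 6)).
  apply: (sem_for (I := fun i st' => regs st' 0 = has (lucky (2 ^ b) b.+1 k) (iota 0 i))) => //.
  move=> i st1 _ k9 fr1 IH; have [f1 _ _] := fr1.
  have hasS a : has a (iota 0 i.+1) = has a (iota 0 i) || a i.
    by rewrite -addn1 iotaD has_cat /= orbF.
  have := path_spec (ready_frame fr1 isT rst); rewrite (f1 5) // => /(_ r5).
  rewrite (f1 6) // (f1 7) // (f1 8) // k9 IH r6 r7 r8 hasS; move: (sem path_prog st1) => st2 e0.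
  by rewrite /= e0; case: lucky; case: has.
rewrite r6; congr nat_of_bool; apply/hasP/idP => [[c _ /andP[cD kD]]|wk].
  by apply/cover_withinP; exists (final (2 ^ b) b.+1 c); rewrite sub0set.
have [c cb hc] := branch_complete edges_s (leqnn b) wk (gap wk).
exists c; first by rewrite mem_iota add0n cb.
by move: hc; rewrite subnn muln1.
Qed.

End Enumeration.

(** * The decision procedure *)

Definition preamble : prog :=
  PAsg 1 (Defs.Mem (Const 0)) ;;
  PAsg 2 (Defs.Mem (Const 1)) ;;
  PAsg 3 (Defs.Mem (Const 2)) ;;
  PAsg 4 (Add (Const 3) (Add (Reg 2) (Reg 2))) ;;
  PAsg 5 (Add (Reg 1) (Const 1)) ;;
  PAsg 31 (Add (Add (Add (Reg 3) (Reg 3)) (Add (Reg 3) (Reg 3))) (Const 2)) ;;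
  PAsg 7 (Add (Reg 31) (Const 1)) ;;
  PAsg 6 (Const 1).

Definition distance (r r' : nat) : expr :=
  Add (Defs.Sub (Reg r) (Reg r')) (Defs.Sub (Reg r') (Reg r)).

Definition count_degree : prog :=
  PAsg 28 (Const 0) ;;
  for_edges
    (PIf (distance 16 27) PSkip (PAsg 28 (Add (Reg 28) (Const 1))) ;;
     PIf (distance 17 27) PSkip (PAsg 28 (Add (Reg 28) (Const 1)))).

Definition greedy_prog : prog :=
  PIf (distance 28 26) PSkip
    (PIf (Defs.Sub (Add (Reg 29) (Reg 26)) (Reg 2)) PSkip
       (PAsg 30 (Add (Reg 30) (Const 1)) ;; PAsg 29 (Add (Reg 29) (Reg 26)))).

Definition annihilation_prog : prog :=
  PFor 26 1 (PFor 27 1 (count_degree ;; greedy_prog)).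

Definition double_prog : prog := PFor 32 31 (PAsg 6 (Add (Reg 6) (Reg 6))).

(** If the annihilation number is at most l the answer is trivially positive; otherwise the cover
    bound in register 8 is below [n], as the passage from independent sets to covers requires. *)
Definition decide : prog :=
  PAsg 8 (Defs.Sub (Add (Reg 1) (Reg 3)) (Reg 30)) ;;
  PIf (Defs.Sub (Reg 30) (Reg 3)) solve (PAsg 0 (Const 1)).

(** Compiled in three pieces because [bounds_ok] fails for the whole: the first two pieces compute
    registers that bound loops of later ones. Each piece is timed from the registers it starts
    with. *)
Definition main_program : program :=
  Seq (compile preamble)
    (Seq (compile (annihilation_prog ;; double_prog)) (compile decide)).

Section Correctness.
Variables (n l : nat) (e : rel 'I_n) (s : seq ('I_n * 'I_n)).
Hypotheses (sym_e : symmetric e) (irr_e : irreflexive e).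
Hypothesis list_s : edge_listing e s.

Let ready := ready l s.

Lemma eval_distance st r r' : (eval st (distance r r') == 0) = (regs st r == regs st r').
Proof. by rewrite /= addn_eq0 !subn_eq0 eqn_leq. Qed.

Lemma count_degree_spec st (v : 'I_n) : ready st -> regs st 27 = v ->
  regs (sem count_degree st) 28 = degree e v.
Proof.
move=> rst e27; rewrite (degree_listing sym_e irr_e list_s) /count_degree sem_seq.
set st1 := sem (PAsg 28 _) st.
have rst1 : ready st1 := ready_frame (sem_frame st (p := PAsg 28 (Const 0)) isT) isT rst.
apply: (sem_edges (I := fun t st => regs st 28 = \sum_(p <- t) ((p.1 == v) + (p.2 == v)))
          _ _ rst1) => //.
- by move=> t st2 r x; rewrite !inE => /or3P[]/eqP->.
- by rewrite big_nil.
move=> t p st2 ps e1 e2 [f _ _] IH; rewrite sem_seq.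
have e27' : regs st2 27 = v by rewrite f.
set st3 := sem (PIf _ _ _) st2.
have fr3 : frame (PIf (distance 16 27) PSkip (PAsg 28 (Add (Reg 28) (Const 1)))) st2 st3.
  exact: sem_frame.
have [f3 _ _] := fr3.
have step st' r : (regs (sem (PIf (distance r 27) PSkip (PAsg 28 (Add (Reg 28) (Const 1)))) st') 28
    = regs st' 28 + (regs st' r == regs st' 27)).
  rewrite -eval_distance; case: eqP => [E|/eqP E].
    by rewrite sem_else.
  by rewrite sem_then // addn0.
by rewrite step (f3 17) // (f3 27) // e2 e27' step e1 e27' IH -cats1 big_cat big_seq1 /= addnA.
Qed.

Let m := num_edges e.

Lemma annihilation_spec st : 0 < n -> ready st -> regs st 29 = 0 -> regs st 30 = 0 ->
  regs (sem annihilation_prog st) 30 = annihilation_number e.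
Proof.
move=> n0 rst e29 e30; rewrite -(greedy_annihilation (m := m)) ?card_ord //.
set f := (X in foldl X).
have [n1 m1 _ _] := rst.
have : (regs (sem annihilation_prog st) 30, regs (sem annihilation_prog st) 29) =
    foldl f (0, 0) (iota 0 (regs st 1)).
  apply: (sem_for (I := fun k st' =>
    (regs st' 30, regs st' 29) = foldl f (0, 0) (iota 0 k))) => //; first by rewrite /= e29 e30.
  move=> t st1 _ e26 fr1 IH.
  have rst1 : ready st1 := ready_frame fr1 isT rst.
  have -> : foldl f (0, 0) (iota 0 t.+1) = f (foldl f (0, 0) (iota 0 t)) t.
    by rewrite -addn1 iotaD foldl_cat.
  rewrite -IH /f.
  pose g := fun (r : nat * nat) (v : 'I_n) => if degree e v == t then greedy m r t else r.
  have [n1' _ _ _] := rst1.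
  set p := PFor 27 1 _.
  have : (regs (sem p st1) 30, regs (sem p st1) 29) =
      foldl g (regs st1 30, regs st1 29) (take (regs st1 1) (enum 'I_n)).
    apply: (sem_for (I := fun k st' => (regs st' 30, regs st' 29) =
      foldl g (regs st1 30, regs st1 29) (take k (enum 'I_n)))) => //; first by rewrite take0.
    move=> k st2; rewrite {1}n1' => kn e27 fr2 IH2.
    have [v vk] : exists v : 'I_n, v = k :> nat by exists (Ordinal kn).
    have rst2 : ready st2 := ready_frame fr2 isT rst1.
    rewrite -vk take_enum foldl_rcons vk -IH2 (sem_seq count_degree).
    have e28 := count_degree_spec rst2 (etrans e27 (esym vk)).
    have [f3 _ _] := sem_frame st2 (p := count_degree) isT.
    have [f2 _ _] := fr2.
    move: (sem count_degree st2) e28 f3 => st3 e28 f3.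
    have e26' : regs st3 26 = t by rewrite f3 // f2.
    have e2 : regs st3 2 = m by rewrite f3 //; case: rst2 => _ -> _ _; rewrite /m (num_edges_listing list_s).
    rewrite /g -e28 -(f3 30) // -(f3 29) // -e26'; rewrite /greedy_prog.
    rewrite -eval_distance; case: eqP => [E|/eqP E]; last by rewrite sem_then.
    rewrite sem_else // /greedy -subn_eq0 -e2.
    case: eqP => [E2|/eqP E2].
      by rewrite sem_else /= ?addn1.
    by rewrite sem_then //= E2.
  rewrite n1' take_oversize ?size_enum_ord //.
by rewrite n1 => <-.
Qed.

Lemma double_spec st : regs st 6 = 1 -> regs (sem double_prog st) 6 = 2 ^ regs st 31.
Proof.
move=> e6; apply: (sem_for (I := fun k st' => regs st' 6 = 2 ^ k)) => //.
by move=> k st' _ _ _ /= ->; rewrite addnn -mul2n -expnS.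
Qed.

Let input := input_state l s.
Let start := sem preamble input.

Lemma start_regs : ready start /\
  [/\ regs start 5 = n.+1, regs start 3 = l, regs start 31 = 4 * l + 2,
      regs start 7 = (4 * l + 2).+1 &
      [/\ regs start 6 = 1, regs start 0 = 0, regs start 29 = 0 & regs start 30 = 0]].
Proof.
have e31 : l + l + (l + l) + 2 = 4 * l + 2 by clear; lia.
by split; split=> //=; rewrite ?e31 ?addn1.
Qed.

Lemma main_correct : 0 < n ->
  regs (sem decide (sem (annihilation_prog ;; double_prog) start)) 0 =
  (annihilation_number e - l <= independence_number e).
Proof.
move=> n0; rewrite sem_seq.
have [rst [e5 e3 e31 e7 [e6 e0 e29 e30]]] := start_regs.
set a := annihilation_number e.
have le_a : a <= n by rewrite -[n]card_ord; apply: annihilation_le.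
have Ea := annihilation_spec n0 rst e29 e30; rewrite -/a in Ea.
have fr1 := sem_frame start (p := annihilation_prog) isT.
have fr2 := sem_frame (sem annihilation_prog start) (p := double_prog) isT.
have [[f1 _ _] [f2 _ _]] := (fr1, fr2).
have E6 : regs (sem double_prog (sem annihilation_prog start)) 6 = 2 ^ (4 * l + 2).
  by rewrite double_spec f1 // e31.
have rst2 := ready_frame fr2 isT (ready_frame fr1 isT rst).
have F r : r \notin mods annihilation_prog -> r \notin mods double_prog ->
    regs (sem double_prog (sem annihilation_prog start)) r = regs start r.
  by move=> h1 h2; rewrite f2 // f1.
have E30 : regs (sem double_prog (sem annihilation_prog start)) 30 = a by rewrite f2.
have {}e5 := etrans (F 5 isT isT) e5; have {}e3 := etrans (F 3 isT isT) e3.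
have {}e7 := etrans (F 7 isT isT) e7; have {}e0 := etrans (F 0 isT isT) e0.
move: (sem double_prog _) E6 rst2 E30 e5 e3 e7 e0 {F f1 f2 fr1 fr2 Ea e6 e29 e30 e31}.
move=> st E6 rst2 E30 e5 e3 e7 e0; rewrite /decide sem_seq.
set st2 := sem (PAsg 8 _) st.
have e8 : regs st2 8 = n + l - a by rewrite /st2 /= e3 E30; case: rst2 => ->.
have rst3 : ready st2.
  exact: ready_frame (sem_frame st (p := PAsg 8 (Defs.Sub (Add (Reg 1) (Reg 3)) (Reg 30))) isT) isT rst2.
case: (leqP a l) => [le_al|lt_la].
  rewrite sem_else; last by apply/eqP; rewrite /= E30 e3 subn_eq0.
  by rewrite (eqP le_al) leq0n.
rewrite sem_then; last by rewrite /= E30 e3 -lt0n subn_gt0.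
have edges_s := edge_listingE sym_e list_s.
have k_le : n + l - a <= n by move: lt_la le_a; clear; lia.
have -> : a - l = #|'I_n| - (n + l - a) by rewrite card_ord; move: lt_la le_a; clear; lia.
rewrite independence_cover ?card_ord //.
apply: (solve_spec sym_e irr_e edges_s rst3 (b := 4 * l + 2)) => //.
apply: (lp_gap sym_e (handshake_listing sym_e irr_e list_s)); rewrite ?card_ord //.
by rewrite -/a; move: lt_la le_a; clear; lia.
Qed.

End Correctness.

(** * Running time *)

(** Covers the loops bounded by the size of the graph; register 5 holds [n.+1], whence the factor 2.
    Loops whose length depends on l are estimated separately. *)
Definition time_degree p d :=
  exists C, forall rho N, 0 < N -> rho 1 <= N -> rho 2 <= N -> rho 5 <= 2 * N ->
    time_bound rho p <= C * N ^ d.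

Lemma time_degree_loopfree p : bounds p = [::] -> time_degree p 0.
Proof.
move=> b0; exists (time_bound (fun=> 0) p) => rho N _ _ _ _.
by rewrite expn0 muln1 (@eq_time_bound rho (fun=> 0)) // => r; rewrite b0.
Qed.

Lemma time_degree_weaken p d d' : d <= d' -> time_degree p d -> time_degree p d'.
Proof.
move=> dd' [C h]; exists C => rho N N0 h1 h2 h5; apply: leq_trans (h _ _ N0 h1 h2 h5) _.
by rewrite leq_mul2l leq_pexp2l ?orbT.
Qed.

Lemma time_degree_seq p q d : time_degree p d -> time_degree q d ->
  time_degree (p ;; q) d.
Proof.
move=> [C h] [C' h']; exists (C + C') => rho N N0 h1 h2 h5 /=.
by rewrite mulnDl leq_add ?h ?h'.
Qed.

Lemma time_degree_if x p q d : time_degree p d -> time_degree q d ->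
  time_degree (PIf x p q) d.
Proof.
move=> [C h] [C' h']; exists (C + C' + eval_cost x + 1) => rho N N0 h1 h2 h5 /=.
have := h _ _ N0 h1 h2 h5; have := h' _ _ N0 h1 h2 h5.
have : 0 < N ^ d by rewrite expn_gt0 N0.
by move: (N ^ d) (time_bound rho p) (time_bound rho q) (eval_cost x); clear; nia.
Qed.

Lemma time_degree_for i b p d : b \in [:: 1; 2; 5] -> time_degree p d ->
  time_degree (PFor i b p) d.+1.
Proof.
move=> hb [C h]; exists (2 * C + 22) => rho N N0 h1 h2 h5 /=.
have hN : rho b <= 2 * N.
  by move: hb; rewrite !inE => /or3P[]/eqP-> //; move: h1 h2; clear; lia.
have := h _ _ N0 h1 h2 h5; have : 0 < N ^ d by rewrite expn_gt0 N0.
rewrite expnS; move: (N ^ d) (time_bound rho p) (rho b) hN N0; clear.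
move=> X t r rN N0 X0 tX.
have : r * (t + 8) <= 2 * N * (C * X + 8) by apply: leq_mul => //; lia.
have : 1 <= N * X by rewrite muln_gt0 N0.
have : N <= N * X by rewrite leq_pmulr.
lia.
Qed.

Lemma time_search : time_degree search 2.
Proof.
apply: time_degree_seq; first by apply/(@time_degree_weaken _ 1)/time_degree_for/time_degree_loopfree.
apply: time_degree_seq; first by apply/(@time_degree_weaken _ 0)/time_degree_loopfree.
by apply/time_degree_for/time_degree_for/time_degree_loopfree.
Qed.

Lemma time_maximize : time_degree maximize 3.
Proof.
apply/time_degree_for/time_degree_seq/(@time_degree_weaken _ 1) => //; first exact: time_search.
by apply/time_degree_for/time_degree_loopfree.
Qed.

Lemma time_reduce : time_degree reduce_prog 3.
Proof.
have lf p d : bounds p = [::] -> time_degree p d.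
  by move/time_degree_loopfree; apply: time_degree_weaken.
apply: time_degree_for => //; do 2!apply: time_degree_seq (lf _ _ _) _ => //.
do 2!apply: time_degree_if (lf _ _ _) => //.
by apply: time_degree_seq (lf _ _ _) _ => //; apply: time_degree_seq time_search (lf _ _ _).
Qed.

Lemma time_edges body d : bounds body = [::] -> 0 < d -> time_degree (for_edges body) d.
Proof.
move=> b0 d0; apply/(@time_degree_weaken _ 1)/time_degree_for/time_degree_loopfree => //.
Qed.

Lemma time_round : time_degree round 3.
Proof.
apply: time_degree_seq time_maximize _; apply: time_degree_seq time_reduce _.
apply: time_degree_seq; last by apply/(@time_degree_weaken _ 0)/time_degree_loopfree.
apply: time_degree_seq; first by apply/(@time_degree_weaken _ 0)/time_degree_loopfree.
apply: time_degree_seq; first by apply/(@time_degree_weaken _ 0)/time_degree_loopfree.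
exact: time_edges.
Qed.

Lemma time_annihilation : time_degree annihilation_prog 3.
Proof.
do 2!apply: time_degree_for => //.
apply: time_degree_seq; last by apply/(@time_degree_weaken _ 0)/time_degree_loopfree.
apply: time_degree_seq; first by apply/(@time_degree_weaken _ 0)/time_degree_loopfree.
exact: time_edges.
Qed.

Lemma time_path : exists C, forall rho N,
  0 < N -> rho 1 <= N -> rho 2 <= N -> rho 5 <= 2 * N -> 0 < rho 7 ->
  time_bound rho path_prog <= C * (rho 7 * N ^ 3).
Proof.
have lf p d : bounds p = [::] -> time_degree p d.
  by move/time_degree_loopfree; apply: time_degree_weaken.
have [C1 h1] : time_degree clear 3.
  by apply/(@time_degree_weaken _ 1)/time_degree_for/time_degree_loopfree.
have [C2 h2] : time_degree (PAsg 10 (Reg 9)) 3 by apply: lf.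
have [C3 h3] := time_round.
have [C4 h4] : time_degree scan 3.
  by do 2!apply: time_degree_seq (lf _ _ _) _ => //; apply: time_edges.
have [C5 h5] : time_degree (PIf (Reg 12) PSkip check) 3.
  apply: time_degree_if (lf _ _ _) _ => //; apply: time_degree_seq (lf _ _ _) _ => //.
  apply: time_degree_seq (lf _ _ _) => //.
  by apply/(@time_degree_weaken _ 1)/time_degree_for/time_degree_loopfree.
exists (C1 + C2 + C3 + C4 + C5 + 14) => rho N N0 l1 l2 l5 l7.
move: (h1 _ _ N0 l1 l2 l5) (h2 _ _ N0 l1 l2 l5) (h3 _ _ N0 l1 l2 l5).
move: (h4 _ _ N0 l1 l2 l5) (h5 _ _ N0 l1 l2 l5).
rewrite (_ : time_bound rho path_prog = time_bound rho clear +
  (time_bound rho (PAsg 10 (Reg 9)) + (rho 7 * (time_bound rho round + 8) + 6 +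
  (time_bound rho scan + time_bound rho (PIf (Reg 12) PSkip check))))) //.
have X0 : 0 < N ^ 3 by rewrite expn_gt0 N0.
have hX : N ^ 3 <= rho 7 * N ^ 3 by rewrite leq_pmull.
move: (time_bound rho clear) (time_bound rho (PAsg _ _)) (time_bound rho round).
move: (time_bound rho scan) (time_bound rho (PIf _ _ _)) (N ^ 3) (rho 7) l7 X0 hX.
clear=> t4 t5 X r r0 X0 hX t1 t2 t3 b4 b5 b1 b2 b3.
have c C : C * X <= C * (r * X) by rewrite leq_mul2l hX orbT.
have : r * (t3 + 8) <= r * ((C3 + 8) * X) by rewrite leq_mul2l; lia.
rewrite mulnCA; move: (c C1) (c C2) (c C4) (c C5) (leq_trans X0 hX); lia.
Qed.

Lemma time_decide : exists C, forall rho N,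
  0 < N -> rho 1 <= N -> rho 2 <= N -> rho 5 <= 2 * N -> 0 < rho 7 -> 0 < rho 6 ->
  time_bound rho decide <= C * (rho 6 * rho 7 * N ^ 3).
Proof.
have [C h] := time_path.
exists (C + 30) => rho N N0 l1 l2 l5 l7 l6.
have := h _ _ N0 l1 l2 l5 l7.
have -> : time_bound rho decide =
  6 + (3 + maxn (rho 6 * (time_bound rho path_prog + 8) + 6) 2).+1 by [].
have X0 : 0 < N ^ 3 by rewrite expn_gt0 N0.
move: (time_bound rho path_prog) (N ^ 3) (rho 7) (rho 6) X0 l7 l6.
clear=> t X r W X0 r0 W0 ht.
have rX0 : 0 < r * X by rewrite muln_gt0 r0.
have : W * (t + 8) <= W * ((C + 8) * (r * X)) by apply: leq_mul => //; lia.
have : 0 < W * r * X by rewrite !muln_gt0 W0 r0.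
by rewrite mulnCA !mulnA; lia.
Qed.

(** Increasing l by one multiplies the left side by at most 16 * 3 and the power of 15 by 15 ^ 3;
    the induction starts from 12 <= 15. *)
Lemma rounds_le l : 2 ^ (4 * l + 2) * (4 * l + 3) <= 15 ^ (3 * l + 1) * maxn l 1.
Proof.
apply: leq_trans (leq_pmulr _ _); last by rewrite leq_max orbT.
elim: l => // l IH.
have -> : 4 * l.+1 + 2 = 4 + (4 * l + 2) by lia.
have -> : 3 * l.+1 + 1 = 3 + (3 * l + 1) by lia.
rewrite (expnD 2 4) (expnD 15 3) -!mulnA.
have : 2 ^ (4 * l + 2) * (4 * l.+1 + 3) <= 3 * (2 ^ (4 * l + 2) * (4 * l + 3)).
  by rewrite mulnCA leq_mul2l; lia.
move: IH; move: (15 ^ (3 * l + 1)) (2 ^ (4 * l + 2) * _) (2 ^ (4 * l + 2) * _) => A B B'.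
by clear; lia.
Qed.

(* Truncated subtraction is harmless, as the independence number is
   nonnegative.  The factor l is read as maxn l 1, since for l = 0 the literal
   bound would be 0. *)
Theorem theorem2 :
  exists (P : program) (C : nat),
    forall (n : nat) (e : rel 'I_n) (l : nat) (s : seq ('I_n * 'I_n)),
      0 < n -> symmetric e -> irreflexive e -> edge_listing e s ->
      answers_within P (input_state l s)
        (C * (15 ^ (3 * l + 1) * maxn l 1 * (n + num_edges e) ^ 3))
        (annihilation_number e - l <= independence_number e).
Proof.
have [C0 h0] : time_degree preamble 0 by apply: time_degree_loopfree.
have [C1 h1] := time_annihilation.
have [C2 h2] := time_decide.
(* The time of [double_prog] depends on l alone; its cost for a single iteration, overhead included,
   times the number of iterations bounds it. *)
pose C3 := time_bound (fun=> 1) double_prog.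
exists main_program, (C0 + C1 + C3 + C2) => n e l s n0 sym_e irr_e list_s.
pose st1 := sem preamble (input_state l s).
pose st2 := sem (annihilation_prog ;; double_prog) st1.
have [rst [e5 e3 e31 e7 [e6 e0 e29 e30]]] := start_regs l s.
have [t0 [x0 l0]] := exec_compile (p := preamble) (input_state l s) isT isT.
have [t1 [x1 l1]] := exec_compile (p := annihilation_prog ;; double_prog) st1 isT isT.
have [t2 [x2 l2]] := exec_compile (p := decide) st2 isT isT.
exists (t0 + (t1 + t2)), (sem decide st2); split.
- exact: ExecSeq x0 (ExecSeq x1 x2).
- pose N := n + num_edges e; rewrite -/N.
  have N0 : 0 < N by rewrite addn_gt0 n0.
  have [n1 s1 _ _] := rst; rewrite -(num_edges_listing list_s) in s1.
  have nN : n <= N := leq_addr _ _.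
  have mN : num_edges e <= N := leq_addl _ _.
  have n5 : n.+1 <= 2 * N by move: N0 nN; clear; lia.
  have F r : r \notin mods (annihilation_prog ;; double_prog) -> regs st2 r = regs st1 r.
    exact: sem_regs.
  have E6 : regs st2 6 = 2 ^ (4 * l + 2).
    by rewrite /st2 sem_seq double_spec sem_regs // e31.
  have L0 : t0 <= C0 * N ^ 0 by apply: leq_trans l0 _; apply: h0.
  have L1 : t1 <= C1 * N ^ 3 + (4 * l + 2) * C3.
    apply: leq_trans l1 _.
    rewrite (_ : time_bound _ _ = time_bound (regs st1) annihilation_prog + (regs st1 31 * 12 + 6)) //.
    apply: leq_add; first by apply: h1; rewrite ?n1 ?s1 ?e5.
    by rewrite e31 (_ : C3 = 18) //; clear; lia.
  have L2 : t2 <= C2 * (2 ^ (4 * l + 2) * (4 * l + 3) * N ^ 3).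
    apply: leq_trans l2 _; rewrite (_ : 4 * l + 3 = regs st2 7); last by rewrite F // e7 addnS.
    rewrite -E6; apply: h2; rewrite ?E6 ?expn_gt0 // ?F // ?n1 ?s1 ?e5 ?e7 //.
  have X0 : 0 < N ^ 3 by rewrite expn_gt0 N0.
  have W0 : 0 < 2 ^ (4 * l + 2) by rewrite expn_gt0.
  have := rounds_le l; rewrite expn0 muln1 in L0.
  move: (15 ^ (3 * l + 1) * maxn l 1) (2 ^ (4 * l + 2)) (N ^ 3) X0 W0 L0 L1 L2.
  move: C3; clear=> C3 A W X X0 W0 L0 L1 L2 WA.
  have XB : W * (4 * l + 3) * X <= A * X by rewrite leq_mul2r WA orbT.
  have BX : 4 * l + 3 <= W * (4 * l + 3) * X.
    by rewrite mulnAC leq_pmull // muln_gt0 W0.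
  have WX : X <= W * (4 * l + 3) * X by rewrite leq_pmull // muln_gt0 W0 addn3.
  have c1 : C1 * X <= C1 * (A * X) by rewrite leq_mul2l (leq_trans WX XB) orbT.
  have c3 : (4 * l + 2) * C3 <= A * X * C3.
    by rewrite leq_mul2r; apply/orP; right; lia.
  have c2 : C2 * (W * (4 * l + 3) * X) <= C2 * (A * X) by rewrite leq_mul2l XB orbT.
  have c0 : C0 <= C0 * (A * X) by rewrite leq_pmulr //; lia.
  lia.
- exact: main_correct.
Qed.
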